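(* Let $p>1$, let $[X,\mathcal B,m^i,\nu_i]$ ($i=1,2$) be reversible random walk spaces on the same measurable space with $\nu_2\ll\nu_1$, $\mu=\frac{d\nu_2}{d\nu_1}\in L^\infty(X,\nu_1)$, $\mu\ge c>0$ $\nu_1$-a.e., and $\nu_1(X)<\infty$. Assume $\mathcal F_{1,m^1}$ satisfies a $1$-Poincaré inequality with constant $\lambda_1(\mathcal F_{1,m^1})>0$. For $u_0\in L^2(X,\nu_1)$ let $u$ be the strong solution of $u_t-\Delta_1^{m^1}u-\mu\Delta_p^{m^2}u\ni0$, $u(0)=u_0$. Then $$\|u(t)-\overline{u_0}\|_{L^1(X,\nu_1)}\le\frac{1}{2\lambda_1(\mathcal F_{1,m^1})}\,\frac{\|u_0\|^2_{L^2(X,\nu_1)}}{t}\qquad\forall t>0.$$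
   Context: Random walk space $[X,\mathcal B,m,\nu]$: measurable space with countably generated $\sigma$-algebra, probability measures $m_x$ depending measurably on $x$, $\sigma$-finite invariant measure $\nu$ ($\nu(A)=\int m_x(A)\,d\nu(x)$), reversible if $dm_x(y)d\nu(x)=dm_y(x)d\nu(y)$. $\nabla u(x,y)=u(y)-u(x)$. $\mathcal F_{1,m^1}(u)=\frac12\int_{X\times X}|\nabla u|\,dm^1_x(y)d\nu_1(x)$ ($+\infty$ if infinite). $\overline{u}=\frac1{\nu_1(X)}\int_X u\,d\nu_1$. $\mathcal F_{1,m^1}$ satisfies an $r$-Poincaré inequality ($1\le r<\infty$) if there is $\lambda_r(\mathcal F_{1,m^1})>0$ with $\lambda_r\|u-\overline u\|_{L^r(X,\nu_1)}\le\mathcal F_{1,m^1}(u)$ for all $u\in L^r(X,\nu_1)$. $(u,v)\in\Delta_1^{m}$ iff $(u,-v)\in\partial_{L^2(X,\nu)}\mathcal F_{1,m}(u)$ (convex subdifferential). For $p>1$, $(u,w)\in\Delta_p^{m}$ iff $u,w\in L^2(X,\nu)$, $\nabla u\in L^p(dm_x(y)d\nu(x))$ and $w(x)=\int_X|\nabla u(x,y)|^{p-2}\nabla u(x,y)\,dm_x(y)$. The operator $A=-\Delta_1^{m^1}-\mu\Delta_p^{m^2}$ on $H=L^2(X,\nu_1)$: $(u,v)\in A$ iff $u,v\in H$, $v=v_1-\mu w$ with $(u,-v_1)\in\Delta_1^{m^1}$ (w.r.t. $\nu_1$) and $(u,w)\in\Delta_p^{m^2}$ (w.r.t. $\nu_2$).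 Strong solution: $u\in C([0,\infty);H)\cap W^{1,2}_{\rm loc}(0,\infty;H)$, $u(0)=u_0$, $-u_t(t)\in A(u(t))$ for a.e. $t$. *)

(* Defs.v *)
From HB Require Import structures.
From mathcomp Require Import all_boot all_order all_algebra.
From mathcomp Require Import all_classical all_reals all_analysis.
Set Implicit Arguments. Unset Strict Implicit. Unset Printing Implicit Defensive.
Import Order.TTheory GRing.Theory Num.Theory.
Import numFieldNormedType.Exports.
Local Open Scope classical_set_scope.
Local Open Scope ring_scope.

Section RWS.
Context {d : measure_display} {T : measurableType d} {R : realType}.
Local Open Scope ereal_scope.

Definition countably_generated_sigma : Prop :=
  exists G : nat -> set T, (@measurable d T) = <<s range G>>.

Definition invariant_measure (m : R.-pker T ~> T) (nu : {measure set T -> \bar R}) : Prop :=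
  sigma_finite setT nu /\
  forall A, measurable A -> nu A = \int[nu]_x (m x A).

(* Reversibility: dm_x(y) dnu(x) = dm_y(x) dnu(y) as measures on X x X. *)
Definition reversible (m : R.-pker T ~> T) (nu : {measure set T -> \bar R}) : Prop :=
  forall C : set (T * T), measurable C ->
    \int[nu]_x (m x [set y | C (x, y)]) = \int[nu]_x (m x [set y | C (y, x)]).

Definition reversible_rws (m : R.-pker T ~> T) (nu : {measure set T -> \bar R}) : Prop :=
  countably_generated_sigma /\ invariant_measure m nu /\ reversible m nu.

(* f in L^r(X, nu) (via a representative). *)
Definition inLr (nu : {measure set T -> \bar R}) (r : R) (f : T -> R) : Prop :=
  measurable_fun setT f /\ \int[nu]_x ((`|f x| `^ r)%:E) < +oo.

Definition inL2 nu (f : T -> R) := inLr nu 2%R f.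

Definition L2sq (nu : {measure set T -> \bar R}) (f g : T -> R) : \bar R :=
  \int[nu]_x (((f x - g x) ^+ 2)%R%:E).

Definition mean (nu : {measure set T -> \bar R}) (u : T -> R) : R :=
  ((fine (nu setT))^-1 * fine (\int[nu]_x (u x)%:E))%R.

Definition F1 (m : R.-pker T ~> T) (nu : {measure set T -> \bar R}) (u : T -> R) : \bar R :=
  (2^-1)%:E * \int[nu]_x \int[m x]_y ((`|u y - u x|)%:E).

Definition subdiffF1 m nu (u v : T -> R) : Prop :=
  inL2 nu u /\ inL2 nu v /\
  forall z, inL2 nu z ->
    F1 m nu u + \int[nu]_x ((v x * (z x - u x))%R%:E) <= F1 m nu z.

Definition Delta1 m nu (u v : T -> R) : Prop :=
  subdiffF1 m nu u (fun x => - v x)%R.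

Definition Deltap (m : R.-pker T ~> T) (nu : {measure set T -> \bar R}) (p : R)
    (u w : T -> R) : Prop :=
  inL2 nu u /\ inL2 nu w /\
  \int[nu]_x \int[m x]_y ((`|u y - u x| `^ p)%:E) < +oo /\
  {ae nu, forall x, w x =
     Rintegral (m x) setT (fun y => (`|u y - u x| `^ (p - 2) * (u y - u x))%R)}.

Definition opA (m1 m2 : R.-pker T ~> T) (nu1 nu2 : {measure set T -> \bar R})
    (mu : T -> R) (p : R) (u v : T -> R) : Prop :=
  inL2 nu1 u /\ inL2 nu1 v /\
  exists v1 w : T -> R,
    Delta1 m1 nu1 u (fun x => - v1 x)%R /\ Deltap m2 nu2 p u w /\
    {ae nu1, forall x, v x = (v1 x - mu x * w x)%R}.

Definition strong_solution (m1 m2 : R.-pker T ~> T) (nu1 nu2 : {measure set T -> \bar R})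
    (mu : T -> R) (p : R) (u0 : T -> R) (u : R -> T -> R) : Prop :=
  (forall t, (0 <= t)%R -> inL2 nu1 (u t)) /\
  {ae nu1, forall x, u 0%R x = u0 x} /\
  (forall t0 : R, (0 <= t0)%R ->
     (fun t => L2sq nu1 (u t) (u t0)) @ within (fun t => (0 <= t)%R) (nbhs t0) --> 0) /\
  (* W^{1,2}_loc(0,oo;H): ||u(t)-u(s)||_H <= \int_s^t g with g in L^2_loc(0,oo) *)
  (exists g : R -> R,
     (forall a b : R, (0 < a)%R -> (a < b)%R ->
        measurable_fun `[a, b] g /\
        \int[lebesgue_measure]_(tau in `[a, b]) (((g tau) ^+ 2)%R%:E) < +oo) /\
     (forall s t : R, (0 < s)%R -> (s <= t)%R ->
        (Num.sqrt (fine (L2sq nu1 (u t) (u s))) <=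
         fine (\int[lebesgue_measure]_(tau in `[s, t]) (g tau)%:E))%R)) /\
  (exists ut : R -> T -> R,
     {ae lebesgue_measure, forall t, (0 < t)%R ->
        inL2 nu1 (ut t) /\
        (fun h => L2sq nu1 (fun x => ((u (t + h) x - u t x) / h)%R) (ut t))
          @ 0%R^' --> 0 /\
        opA m1 m2 nu1 nu2 mu p (u t) (fun x => - ut t x)%R}).

End RWS.

(* Main.v *)
Require Import Defs.
From HB Require Import structures.
From mathcomp Require Import all_boot all_order all_algebra.
From mathcomp Require Import all_classical all_reals all_analysis.
From mathcomp Require Import measurable_realfun.
From mathcomp Require Import ring lra.
Import Order.TTheory GRing.Theory Num.Theory.
Import numFieldNormedType.Exports.
Local Open Scope classical_set_scope.
Local Open Scope ring_scope.
Set Implicit Arguments.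
Unset Strict Implicit.
Unset Printing Implicit Defensive.

(* Write [-u_t = v - mu w] with [v] in the subdifferential of [F1] at [u] and
   [w = Delta_p u].  For [phi] nondecreasing and Lipschitz, [id - e phi] is a
   contraction for small [e], so testing the subdifferential inequality with
   [u - e phi(u)] gives [\int v phi(u) >= 0]; reversibility gives
   [\int w phi(u) d nu2 <= 0].  Hence [\int j(u(t)) d nu1] is nonincreasing when
   [j' = phi]: with [j = +-id] the mean is conserved, and with [j] a Huber
   regularisation of [|. - c|] the distance [N(t) = ||u(t) - c||_1] to the mean
   [c] of [u0] is nonincreasing.  With [j = (.)^2 / 2], testing by [0] and the Poincare
   inequality give [d/dt ||u||^2 / 2 <= - F1(u) <= - lambda N(t) <= - lambda N(b)]
   on [(0, b)], and integrating over [(0, b)] yields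
   [lambda b N(b) <= ||u0||^2 / 2]. *)

(** * Monotonicity from an a.e. bound on the derivative *)

(** The solution comes as representatives [u t], a scalar bound [g] on its L2 speed and an almost
    everywhere L2 derivative [ut], without a formula recovering [u t - u s] as an integral of [ut].
    So only the scalar functions [t |-> \int j(u t) d nu1] are compared in time, and only from
    above: a bound [j y <= j x + j' x (y - x) + L (y - x)^2] yields both an integrable majorant of
    the increments and an upper bound on right difference quotients, and these two facts suffice for
    monotonicity. At its kink [|. - c|] has no such quadratic bound, whence the Huber function,
    which after division by its parameter [k] stays within [k / 2] of the absolute value. Bounding
    [N(t)] below by the constant [N(b)] makes the dissipation rate constant, so it is enough that
    [\int j(u t) + k t] is nonincreasing; neither [F1 (u t)] nor [N(t)] is ever integrated in time.
    The speed bound is available only away from time 0. Every estimate is therefore proved on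
    [[a, b]] with [0 < a], and [a] is sent to 0 by L2 continuity. Conservation of the mean lets the
    Poincare inequality at each time be read with the fixed constant [c]. *)

Section real_monotonicity.
Context {R : realType}.
Notation leb := (@lebesgue_measure R).
Implicit Types (f G Phi : R -> R) (a b : R).

(** [Phi] may jump downwards, but the integral bound excludes upward jumps. Hence the supremum of
    the points where [Phi] is at most [Phi a] is again such a point, and the last hypothesis pushes
    it up to [b]. *)
Lemma real_induction_le Phi G a b : a <= b ->
  leb.-integrable setT (EFin \o G) -> (forall x, 0 <= G x) ->
  (forall s t, a <= s -> s <= t -> t <= b ->
    Phi t - Phi s <= \int[leb]_(x in `[s, t]) G x) ->
  (forall x, a <= x -> x < b -> exists t, [/\ x < t, t <= b & Phi t <= Phi x]) ->
  Phi b <= Phi a.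
Proof.
move=> ab iG G0 Phi1 Phi2.
pose S := [set x | [/\ a <= x, x <= b & Phi x <= Phi a]].
have Sa : S a by split.
have ubS : ubound S b by move=> x [].
have hsS : has_sup S by split; [exists a|exists b].
have ax : a <= sup S by exact: sup_upper_bound.
have xb : sup S <= b by apply: ge_sup => //; exists a.
have PhiS : Phi (sup S) <= Phi a.
  apply/ler_addgt0Pr => e e0.
  have [dl [dl0 Hdl]] := integral_normr_continuous iG e0.
  have [s [as_ sb Phis] xs] := sup_adherent dl0 hsS.
  have sx : s <= sup S by exact: sup_upper_bound.
  have := Phi1 _ _ as_ sx xb.
  have : \int[leb]_(x in `[s, sup S]) `|G x| < e.
    apply: Hdl => //.
    by rewrite /= lebesgue_measure_itv/= lte_fin; case: ifPn => _; rewrite ?lte_fin; lra.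
  under eq_Rintegral do rewrite ger0_norm//.
  by lra.
have [bx|xltb] := leP b (sup S).
  by have -> : b = sup S by apply/eqP; rewrite eq_le bx xb.
have [t [xt tb Pt]] := Phi2 _ ax xltb.
have : S t by split => //; [lra|exact: le_trans PhiS].
by move=> /(sup_upper_bound hsS); lra.
Qed.

(* The null set of bad points is covered by an open [U] over which [G] has small
   integral; subtracting [\int[a,t] G 1_U] from [f] makes every point good. *)
Lemma ae_upper_derivative_le0 f G a b : a < b ->
  leb.-integrable setT (EFin \o G) -> (forall x, 0 <= G x) ->
  (forall s t, a <= s -> s <= t -> t <= b ->
    f t - f s <= \int[leb]_(x in `[s, t]) G x) ->
  {ae leb, forall t, a <= t -> t < b -> forall e eta, 0 < e -> 0 < eta ->
     exists h, [/\ 0 < h, h < eta & f (t + h) - f t <= e * h]} ->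
  f b <= f a.
Proof.
move=> ab iG G0 f1 [N [mN N0 subN]].
apply/ler_addgt0Pr => e e0.
have e20 : 0 < e / 2 by rewrite divr_gt0.
have [dl [dl0 Hdl]] := integral_normr_continuous iG e20.
have [|U [oU NU UN]] := lebesgue_regularity_outer mN _ dl0.
  by rewrite /= [X in (X < _)%E]N0 ltry.
have mU : measurable U by exact: open_measurable.
have muU : (leb U < dl%:E)%E.
  apply: le_lt_trans UN.
  rewrite -[leRHS]adde0 -[X in (_ <= _ + X)%E]N0.
  rewrite -{1}(setDUK NU) setUC.
  by apply: measureU2 => //; exact: measurableD.
pose Gu := G \_ U.
have Gu0 x : 0 <= Gu x by rewrite /Gu patchE; case: ifP.
have iGu : leb.-integrable setT (EFin \o Gu).
  rewrite /Gu -restrict_EFin.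
  apply/(integrable_restrict leb mU measurableT (EFin \o G)).1.
  by rewrite setTI; exact: integrableS iG.
have iGA (A : set R) : measurable A -> leb.-integrable A (EFin \o G).
  by move=> mA; exact: integrableS iG.
have iGuA (A : set R) : measurable A -> leb.-integrable A (EFin \o Gu).
  by move=> mA; exact: integrableS iGu.
pose psi t := \int[leb]_(x in `[a, t]) Gu x.
have psiB s t : a <= s -> s <= t -> psi t - psi s = \int[leb]_(x in `[s, t]) Gu x.
  move=> as_ st; rewrite /psi Rintegral_itvB ?bnd_simp//; last exact: iGuA.
  by rewrite Rintegral_itv_obnd_cbnd//; exact: iGuA.
have psi_ge s t : a <= s -> s <= t -> 0 <= psi t - psi s.
  by move=> as_ st; rewrite psiB//; exact: Rintegral_ge0.
have psib : psi b < e / 2.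
  rewrite /psi /Gu -Rintegral_mkcondr.
  have := Hdl (`[a, b] `&` U) ltac:(exact: measurableI) _.
  under eq_Rintegral do rewrite ger0_norm//.
  apply; apply: le_lt_trans muU; apply: le_measure; rewrite ?inE//.
  exact: measurableI.
have psia : psi a = 0 by rewrite /psi set_itv1 Rintegral_set1.
(* The allowance [e] is split in two: half pays for [psi b], half for the tilt [k * t] across
   [[a, b]]. *)
pose k := e / 2 / (b - a).
have k0 : 0 < k by rewrite divr_gt0// subr_gt0.
have kab : k * (b - a) = e / 2 by rewrite /k divfK// subr_eq0 gt_eqF.
suff : f b - psi b - k * b <= f a - psi a - k * a by rewrite psia; nra.
apply: (@real_induction_le (fun t => f t - psi t - k * t) _ _ _ (ltW ab) iG) => //.
  move=> s t as_ st tb; have := f1 _ _ as_ st tb; have := psi_ge _ _ as_ st.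
  have : k * s <= k * t by rewrite ler_pM2l.
  by lra.
(* Inside [U] the growth of [psi] equals the majorant of the growth of [f] on a short interval;
   outside, [x] is not in [N] and the derivative hypothesis applies with slope [k]. *)
move=> x ax xb; have [Ux|nUx] := pselect (U x).
  have /= [r rpos rU] := open_subball oU Ux.
  have r0 : 0 < r := rpos.
  (* The ball of radius [r / 2] lies in [U]; the second halving keeps the closed interval [[x, t]]
     strictly inside it. *)
  pose t := Num.min b (x + r / 2 / 2).
  have xt : x < t by rewrite /t lt_min xb/=; lra.
  have tb : t <= b by rewrite /t ge_min lexx.
  have tr : t <= x + r / 2 / 2 by rewrite /t ge_min lexx orbT.
  exists t; split => //.
  have kx : k * x <= k * t by rewrite ler_pM2l// ltW.
  have := f1 _ _ ax (ltW xt) tb.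
  have := psiB _ _ ax (ltW xt).
  suff -> : \int[leb]_(y in `[x, t]) Gu y = \int[leb]_(y in `[x, t]) G y by lra.
  apply: eq_Rintegral.
  move=> y; rewrite inE/= in_itv/= => /andP[xy yt].
  rewrite /Gu patchE ifT// inE; apply: (rU (r / 2)) => //=.
  - by rewrite sub0r normrN ger0_norm; lra.
  - by lra.
  - by rewrite /ball/= ler0_norm; lra.
have : ~ N x by move=> /NU.
move=> /(contra_notP (@subN x)) /(_ ax xb k (b - x) k0)[|h [h0 hb fh]].
  by rewrite subr_gt0.
exists (x + h); split; [lra|lra|].
have := psi_ge x (x + h) ax; lra.
Qed.

End real_monotonicity.

(** * Positive functionals, densities and reversibility *)

Section ge0_functional.
Context {d : measure_display} {Z : measurableType d} {R : realType}.
Local Open Scope ereal_scope.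
Implicit Types (I J : (Z -> \bar R) -> \bar R) (f g : Z -> \bar R).

Definition ge0_mfun f := measurable_fun setT f /\ forall z, 0 <= f z.

Definition ge0_functional I := [/\
  forall f, ge0_mfun f -> 0 <= I f,
  forall f g, ge0_mfun f -> ge0_mfun g -> (forall z, f z <= g z) -> I f <= I g,
  forall f g, ge0_mfun f -> ge0_mfun g -> I (fun z => f z + g z) = I f + I g,
  forall (k : R) f, (0 <= k)%R -> ge0_mfun f ->
    I (fun z => k%:E * f z) = k%:E * I f &
  forall f_ : nat -> Z -> \bar R, (forall n, ge0_mfun (f_ n)) ->
    (forall z, nondecreasing_seq (f_ ^~ z)) ->
    I (fun z => limn (f_ ^~ z)) = limn (fun n => I (f_ n))].

Lemma ge0_mfun_indic (A : set Z) : measurable A ->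
  ge0_mfun (fun z => (\1_A z)%:E).
Proof.
move=> mA; split => [|z]; last by rewrite lee_fin.
exact/measurable_EFinP/measurable_indic.
Qed.

Lemma ge0_mfunZ (k : R) f : (0 <= k)%R -> ge0_mfun f ->
  ge0_mfun (fun z => k%:E * f z).
Proof.
move=> k0 [mf f0]; split => [|z]; last by rewrite mule_ge0.
exact: measurable_funeM.
Qed.

Lemma ge0_functional_sum I (T : Type) (s : seq T) (F : T -> Z -> \bar R) :
  ge0_functional I -> (forall i, ge0_mfun (F i)) ->
  I (fun z => \sum_(i <- s) F i z) = \sum_(i <- s) I (F i).
Proof.
move=> [_ _ ID IZ _] F0.
have F0s t : ge0_mfun (fun z => \sum_(i <- t) F i z).
  split; last by move=> z; apply: sume_ge0 => i _; exact: (F0 i).2.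
  by apply: emeasurable_sum => i; exact: (F0 i).1.
elim: s => [|x s IHs].
  under eq_fun do rewrite big_nil.
  have /(IZ 0%R _ (lexx _)) : ge0_mfun (cst 0 : Z -> \bar R).
    by split => //; exact: measurable_cst.
  rewrite mul0e big_nil; apply: etrans; congr I.
  by apply/funext => z; rewrite mul0e.
under eq_fun do rewrite big_cons.
by rewrite ID// IHs big_cons.
Qed.

Import HBNNSimple.

Lemma eq_ge0_functional I J : ge0_functional I -> ge0_functional J ->
  (forall A, measurable A ->
    I (fun z => (\1_A z)%:E) = J (fun z => (\1_A z)%:E)) ->
  forall f, ge0_mfun f -> I f = J f.
Proof.
move=> hI hJ IJ f [mf f0].
have [_ _ _ IZ Imct] := hI; have [_ _ _ JZ Jmct] := hJ.
pose f_ := nnsfun_approx measurableT mf.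
have mf_ n : ge0_mfun (fun z => (f_ n z)%:E).
  by split => [|z]; [exact/measurable_EFinP|rewrite lee_fin].
have ndf_ z : nondecreasing_seq (fun n => (f_ n z)%:E).
  by move=> m n mn; rewrite lee_fin; exact/lefP/nd_nnsfun_approx.
have -> : f = (fun z => limn (fun n => (f_ n z)%:E)).
  apply/funext => z; apply/esym/cvg_lim => //.
  by apply: cvg_nnsfun_approx => // ? _.
rewrite Imct// Jmct//; congr (limn _); apply/funext => n.
(* The absolute value makes [F r] nonnegative for every real [r], as the sum lemma demands; on the
   range of [f_ n] it changes nothing. *)
pose F (r : R) z := `|r|%:E * (\1_(f_ n @^-1` [set r]) z)%:E.
have mF r : measurable (f_ n @^-1` [set r]) by exact: measurable_sfunP.
have F0 r : ge0_mfun (F r) by apply: ge0_mfunZ => //; exact: ge0_mfun_indic.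
have -> : (fun z => (f_ n z)%:E) =
    (fun z => \sum_(r <- finmap.enum_fset (fset_set (range (f_ n)))) F r z).
  apply/funext => z; rewrite fimfunE fsbig_finite//= -sumEFin.
  rewrite big_seq [RHS]big_seq; apply: eq_bigr => r.
  rewrite in_fset_set// inE => -[y _ <-].
  by rewrite /F ger0_norm// EFinM.
rewrite !ge0_functional_sum//; apply: eq_bigr => r _.
rewrite /F IZ//; last exact: ge0_mfun_indic.
by rewrite JZ//; [rewrite IJ|exact: ge0_mfun_indic].
Qed.

Lemma ge0_functional_integral (nu : {measure set Z -> \bar R}) :
  ge0_functional (fun f => \int[nu]_z f z).
Proof.
split.
- by move=> f [_ f0]; exact: integral_ge0.
- by move=> f g [mf f0] [mg g0] fg; exact: ge0_le_integral.
- by move=> f g [mf f0] [mg g0]; exact: ge0_integralD.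
- by move=> k f k0 [mf f0]; rewrite ge0_integralZl// lee_fin.
- move=> f_ f0 nd; apply: monotone_convergence => //.
  + by move=> n; exact: (f0 n).1.
  + by move=> n z _; exact: (f0 n).2.
Qed.

End ge0_functional.

Section ge0_functional_comp.
Context {d d' : measure_display} {Z : measurableType d} {W : measurableType d'}.
Context {R : realType}.
Local Open Scope ereal_scope.

Lemma ge0_functional_precomp (I : (Z -> \bar R) -> \bar R) (phi : Z -> W) :
  ge0_functional I -> measurable_fun setT phi ->
  ge0_functional (fun f => I (fun z => f (phi z))).
Proof.
move=> [I0 Ile ID IZ Imct] mphi.
have mc f : ge0_mfun f -> ge0_mfun (fun z => f (phi z)).
  by move=> [mf f0]; split => // ; exact: measurableT_comp.
split.
- by move=> f f0; apply/I0/mc.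
- by move=> f g f0 g0 fg; apply: Ile => //; exact: mc.
- by move=> f g f0 g0; rewrite ID//; exact: mc.
- by move=> k f k0 f0; rewrite IZ//; exact: mc.
- move=> f_ f0 nd.
  by rewrite (Imct (fun n z => f_ n (phi z)))// => n; exact: mc.
Qed.

Lemma ge0_functional_integral_comp (nu : {measure set W -> \bar R})
    (L : W -> (Z -> \bar R) -> \bar R) :
  (forall w, ge0_functional (L w)) ->
  (forall f, ge0_mfun f -> measurable_fun setT (L ^~ f)) ->
  ge0_functional (fun f => \int[nu]_w L w f).
Proof.
move=> hL mL.
have mc f : ge0_mfun f -> ge0_mfun (L ^~ f).
  by move=> f0; split; [exact: mL|move=> w; have [L0 _ _ _ _] := hL w; exact: L0].
have [I0 Ile ID IZ Imct] := ge0_functional_integral nu.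
split.
- by move=> f f0; apply/I0/mc.
- move=> f g f0 g0 fg; apply: Ile; [exact: mc|exact: mc|].
  by move=> w; have [_ Lle _ _ _] := hL w; exact: Lle.
- move=> f g f0 g0; rewrite -ID; [|exact: mc|exact: mc].
  by apply: eq_integral => w _; have [_ _ H _ _] := hL w; exact: H.
- move=> k f k0 f0; rewrite -IZ//; last exact: mc.
  by apply: eq_integral => w _; have [_ _ _ H _] := hL w; exact: H.
- move=> f_ f0 nd; rewrite -Imct//.
  + by apply: eq_integral => w _; have [_ _ _ _ H] := hL w; exact: H.
  + by move=> n; exact: mc.
  + move=> w m n mn; have [_ H _ _ _] := hL w; apply: H => //.
    by move=> z; exact: nd.
Qed.

End ge0_functional_comp.

Section density.
Context {d : measure_display} {T : measurableType d} {R : realType}.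
Variables (nu1 nu2 : {measure set T -> \bar R}) (mu : T -> R).
Hypothesis mmu : measurable_fun setT mu.
Hypothesis mu0 : forall x, (0 <= mu x)%R.
Hypothesis nu2E : forall A, measurable A -> nu2 A = (\int[nu1]_(x in A) (mu x)%:E)%E.
Local Open Scope ereal_scope.

(** The right side integrates over [x] the functional [g |-> mu x * g x], so both sides are positive
    functionals, and [nu2E] is their agreement on indicators. *)
Lemma ge0_integral_density (f : T -> \bar R) : ge0_mfun f ->
  \int[nu2]_x f x = \int[nu1]_x ((mu x)%:E * f x).
Proof.
move=> f0; pose I g := \int[nu2]_x g x; pose J g := \int[nu1]_x ((mu x)%:E * g x).
apply: (@eq_ge0_functional _ _ _ I J) => //; first exact: ge0_functional_integral.
  rewrite /J; apply: ge0_functional_integral_comp => [w|{}f {f0} [mf f0]]; last first.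
    by apply: emeasurable_funM => //; exact/measurable_EFinP.
  split => [g [_ g0]|g h _ _ gh|g h [_ g0] [_ h0]|k g k0 _|f_ f_0 nd].
  - by rewrite mule_ge0// lee_fin.
  - by rewrite lee_wpmul2l// lee_fin.
  - by rewrite ge0_muleDr.
  - by rewrite muleCA.
  - rewrite limeMl//; exact: ereal_nondecreasing_is_cvgn.
move=> A mA; rewrite /I /J integral_indic// setIT nu2E//.
rewrite integral_mkcond; apply: eq_integral => x _.
by rewrite patchE indicE; case: ifPn; rewrite ?mule1 ?mule0.
Qed.

(** As [mu >= 0] commutes with positive and negative parts, both sides are the same difference of
    extended reals, even when that difference is degenerate. *)
Lemma integral_density (f : T -> \bar R) : measurable_fun setT f ->
  \int[nu2]_x f x = \int[nu1]_x ((mu x)%:E * f x).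
Proof.
move=> mf; rewrite integralE [RHS]integralE; congr (_ - _).
  rewrite ge0_integral_density//; last by split => //; exact: measurable_funepos.
  by apply: eq_integral => x _; rewrite !funeposE maxe_pMr ?mule0 ?lee_fin.
rewrite ge0_integral_density//; last by split => //; exact: measurable_funeneg.
by apply: eq_integral => x _; rewrite !funenegE -muleN maxe_pMr ?mule0 ?lee_fin.
Qed.

End density.

Section reversible.
Context {d : measure_display} {T : measurableType d} {R : realType}.
Variables (m : R.-pker T ~> T) (nu : {measure set T -> \bar R}).
Hypothesis rev_m : reversible m nu.
Local Open Scope ereal_scope.

Lemma measurable_fun_kernel_integral (f : T * T -> \bar R) : ge0_mfun f ->
  measurable_fun setT (fun x => \int[m x]_y f (x, y)).
Proof.
move=> [mf f0]; exact: (@measurable_fun_integral_sfinite_kernel _ _ _ _ _ f m).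
Qed.

Lemma measurable_fun_swap_pair : measurable_fun setT (fun z : T * T => (z.2, z.1)).
Proof. exact: measurable_fun_pair. Qed.

(** Both iterated integrals are positive functionals of [f], and [reversible] is their equality on
    indicators of measurable sets of pairs. *)
Lemma ge0_reversible_integral (f : T * T -> \bar R) : ge0_mfun f ->
  \int[nu]_x \int[m x]_y f (x, y) = \int[nu]_x \int[m x]_y f (y, x).
Proof.
have mp1 (x : T) : measurable_fun setT (fun y : T => (x, y)).
  exact: measurable_fun_pair.
have mp2 (x : T) : measurable_fun setT (fun y : T => (y, x)).
  exact: measurable_fun_pair.
move=> f0; pose I g := \int[nu]_x \int[m x]_y g (x, y).
pose J g := \int[nu]_x \int[m x]_y g (y, x).
apply: (@eq_ge0_functional _ _ _ I J _ _ _ _ f0).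
- rewrite /I; apply: ge0_functional_integral_comp => [x|]; last first.
    exact: measurable_fun_kernel_integral.
  by apply: ge0_functional_precomp => //; exact: ge0_functional_integral.
- rewrite /J; apply: ge0_functional_integral_comp => [x|{f0} {}f [mf f0]].
    by apply: ge0_functional_precomp => //; exact: ge0_functional_integral.
  apply: (@measurable_fun_kernel_integral (fun z => f (z.2, z.1))); split => //.
  by apply: measurableT_comp => //; exact: measurable_fun_swap_pair.
- move=> A mA; have := rev_m mA.
  have indE (phi : T -> T * T) x : measurable_fun setT phi ->
      \int[m x]_y (\1_A (phi y))%:E = m x [set y | A (phi y)].
    move=> mphi; have mB : measurable (phi @^-1` A).
      by rewrite -[X in measurable X]setTI; exact: mphi.
    rewrite -[in RHS](setIT [set y | A (phi y)]) -integral_indic//.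
  move=> E; transitivity (\int[nu]_x m x [set y | A (x, y)]).
    by apply: eq_integral => x _; rewrite (indE (fun y => (x, y))).
  by rewrite E; apply: eq_integral => x _; rewrite (indE (fun y => (y, x))).
Qed.

End reversible.

(** * Square-integrable functions *)

Section L2.
Context {d : measure_display} {T : measurableType d} {R : realType}.
Variable nu : {measure set T -> \bar R}.
Implicit Types f g : T -> R.

Lemma inL2P f : inL2 nu f <->
  measurable_fun setT f /\ nu.-integrable setT (fun x => (f x ^+ 2)%:E).
Proof.
have E x : `|f x| `^ 2 = f x ^+ 2 by rewrite powR_mulrn// real_normK// num_real.
split => -[mf If]; split => //.
  apply/integrableP; split; first exact/measurable_EFinP/measurable_funX.
  by under eq_integral do rewrite gee0_abs ?lee_fin ?sqr_ge0// -E.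
under eq_integral do rewrite E; exact: integrable_lty If.
Qed.

Lemma inL2_meas f : inL2 nu f -> measurable_fun setT f.
Proof. by case. Qed.

Lemma inL2_sqr f : inL2 nu f -> nu.-integrable setT (fun x => (f x ^+ 2)%:E).
Proof. by move=> /inL2P[]. Qed.

Lemma le_integrable_fun f (h : T -> R) : measurable_fun setT f ->
  nu.-integrable setT (fun x => (h x)%:E) -> (forall x, `|f x| <= h x) ->
  nu.-integrable setT (fun x => (f x)%:E).
Proof.
move=> mf ih fh; apply: le_integrable ih => //; first exact/measurable_EFinP.
by move=> x _ /=; rewrite lee_fin (le_trans (fh x))// ler_norm.
Qed.

Lemma integrableD_fun f g : nu.-integrable setT (fun x => (f x)%:E) ->
  nu.-integrable setT (fun x => (g x)%:E) ->
  nu.-integrable setT (fun x => (f x + g x)%:E).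
Proof. by move=> fi gi; have := integrableD measurableT fi gi. Qed.

Lemma integrableB_fun f g : nu.-integrable setT (fun x => (f x)%:E) ->
  nu.-integrable setT (fun x => (g x)%:E) ->
  nu.-integrable setT (fun x => (f x - g x)%:E).
Proof. by move=> fi gi; have := integrableB measurableT fi gi. Qed.

Lemma integrableZ_fun (k : R) f : nu.-integrable setT (fun x => (f x)%:E) ->
  nu.-integrable setT (fun x => (k * f x)%:E).
Proof. by move=> fi; have := integrableZl measurableT k fi. Qed.

Lemma inL2M f g : inL2 nu f -> inL2 nu g ->
  nu.-integrable setT (fun x => (f x * g x)%:E).
Proof.
move=> /inL2P[mf fi] /inL2P[mg gi].
apply: le_integrable_fun (integrableD_fun fi gi) _; first exact: measurable_funM.
by move=> x; rewrite ler_norml; apply/andP; split; nra.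
Qed.

(** Integrability of the constant is a hypothesis so that [A = 0] serves for a measure of any
    mass. *)
Lemma inL2_le f g (A B : R) : inL2 nu f -> measurable_fun setT g ->
  nu.-integrable setT (fun=> A%:E) ->
  (forall x, g x ^+ 2 <= A + B * f x ^+ 2) -> inL2 nu g.
Proof.
move=> /inL2P[mf fi] mg iA gf; apply/inL2P; split => //.
apply: le_integrable_fun (integrableD_fun iA (integrableZ_fun B fi)) _.
  exact: measurable_funX.
by move=> x; rewrite ger0_norm ?sqr_ge0.
Qed.

Lemma inL2Z (k : R) f : inL2 nu f -> inL2 nu (fun x => k * f x).
Proof.
move=> fL; apply: (@inL2_le _ _ 0 (k ^+ 2) fL).
- by apply: measurable_funM => //; exact: inL2_meas fL.
- exact: integrable0.
- by move=> x; rewrite add0r exprMn.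
Qed.

Lemma inL2D f g : inL2 nu f -> inL2 nu g -> inL2 nu (fun x => f x + g x).
Proof.
move=> /inL2P[mf fi] /inL2P[mg gi]; apply/inL2P; split.
  exact: measurable_funD.
apply: le_integrable_fun
  (integrableD_fun (integrableZ_fun 2 fi) (integrableZ_fun 2 gi)) _.
  by apply: measurable_funX; exact: measurable_funD.
by move=> x; rewrite ger0_norm ?sqr_ge0//; have := sqr_ge0 (f x - g x); nra.
Qed.

Lemma inL2N f : inL2 nu f -> inL2 nu (fun x => - f x).
Proof.
by move=> /(inL2Z (-1)); under eq_fun do rewrite mulN1r.
Qed.

Lemma inL2B f g : inL2 nu f -> inL2 nu g -> inL2 nu (fun x => f x - g x).
Proof. by move=> fL /inL2N; exact: inL2D. Qed.

Lemma Cauchy_Schwarz_inL2 f g : inL2 nu f -> inL2 nu g ->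
  `|\int[nu]_x (f x * g x)| <=
  Num.sqrt (\int[nu]_x (f x ^+ 2)) * Num.sqrt (\int[nu]_x (g x ^+ 2)).
Proof.
move=> fL gL; have fi := inL2_sqr fL; have gi := inL2_sqr gL.
have fgi := inL2M fL gL.
set X := \int[nu]_x (f x ^+ 2); set Y := \int[nu]_x (g x ^+ 2).
set Z := \int[nu]_x (f x * g x).
have X0 : 0 <= X by apply: Rintegral_ge0 => x _; exact: sqr_ge0.
have Y0 : 0 <= Y by apply: Rintegral_ge0 => x _; exact: sqr_ge0.
have quad s : 0 <= s ^+ 2 * X + 2 * s * Z + Y.
  have : 0 <= \int[nu]_x (s ^+ 2 * f x ^+ 2 + 2 * s * (f x * g x) + g x ^+ 2).
    by apply: Rintegral_ge0 => x _; have := sqr_ge0 (s * f x + g x); nra.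
  rewrite RintegralD//; last first.
    by apply: integrableD_fun; exact: integrableZ_fun.
  rewrite RintegralD//; [|exact: integrableZ_fun|exact: integrableZ_fun].
  by rewrite !RintegralZl.
suff ZXY : Z ^+ 2 <= X * Y.
  by rewrite -sqrtrM// -sqrtr_sqr ler_wsqrtr.
have [X00|X00] := eqVneq X 0.
  have [->|Z0] := eqVneq Z 0; first by rewrite expr0n mulr_ge0.
  (* For [X = 0] the quadratic is affine in [s], and this [s] would give it the value [-1]. *)
  have := quad (- (Y + 1) / (2 * Z)).
  rewrite X00 mulr0 add0r.
  have -> : 2 * (- (Y + 1) / (2 * Z)) * Z = - (Y + 1) by field.
  by lra.
(* The minimiser of the quadratic. *)
have := quad (- Z / X).
have -> : (- Z / X) ^+ 2 * X + 2 * (- Z / X) * Z + Y = (X * Y - Z ^+ 2) / X by field.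
by rewrite pmulr_lge0 ?invr_gt0 ?lt_def ?X00// subr_ge0.
Qed.

Lemma Rintegral_sqrD_le f g : inL2 nu f -> inL2 nu g ->
  \int[nu]_x ((f x + g x) ^+ 2) <=
  2 * \int[nu]_x (f x ^+ 2) + 2 * \int[nu]_x (g x ^+ 2).
Proof.
move=> fL gL; have fi := inL2_sqr fL; have gi := inL2_sqr gL.
rewrite -!RintegralZl// -RintegralD//; try exact: integrableZ_fun.
apply: le_Rintegral => //; first exact/inL2_sqr/inL2D.
  by apply: integrableD_fun; exact: integrableZ_fun.
by move=> x _; have := sqr_ge0 (f x - g x); nra.
Qed.

Lemma L2sqE f g : inL2 nu f -> inL2 nu g ->
  L2sq nu f g = (\int[nu]_x ((f x - g x) ^+ 2))%:E.
Proof.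
move=> fL gL; rewrite /L2sq /Rintegral fineK//.
by apply: integrable_fin_num => //; exact/inL2_sqr/inL2B.
Qed.

Hypothesis nu_fin : fin_num_fun nu.

Lemma integrable_cst_fun (k : R) : nu.-integrable setT (fun=> k%:E).
Proof.
apply/integrableP; split; first exact: measurable_cst.
by rewrite integral_cst//= lte_mul_pinfty// ltey_eq nu_fin.
Qed.

Lemma inL2_cst (k : R) : inL2 nu (fun=> k).
Proof. by apply/inL2P; split; [exact: measurable_cst|exact: integrable_cst_fun]. Qed.

Lemma inL2_integrable f : inL2 nu f -> nu.-integrable setT (fun x => (f x)%:E).
Proof.
by move=> /inL2M /(_ (inL2_cst 1)); under eq_fun do rewrite mulr1.
Qed.

End L2.

(** * Decrease of integral functionals along curves in L2 *)

Section decrease.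
Context {d : measure_display} {T : measurableType d} {R : realType}.
Notation leb := (@lebesgue_measure R).
Variable nu : {measure set T -> \bar R}.
Hypothesis nu_fin : fin_num_fun nu.

Lemma sqr_integrable_itv (g : R -> R) (a b : R) :
  measurable_fun `[a, b] g ->
  (\int[leb]_(t in `[a, b]) ((g t ^+ 2)%:E) < +oo)%E ->
  leb.-integrable `[a, b] (EFin \o g).
Proof.
move=> mg g2.
have i1 : leb.-integrable `[a, b] (EFin \o cst 1).
  apply: measurable_bounded_integrable => //.
    by rewrite /= lebesgue_measure_itv/=; case: ifP => _; exact: ltry.
  exact: bounded_cst.
have i2 : leb.-integrable `[a, b] (EFin \o (fun t => g t ^+ 2)).
  apply/integrableP; split; first exact/measurable_EFinP/measurable_funX.
  by under eq_integral do rewrite /= ger0_norm ?sqr_ge0//.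
apply: le_integrable (integrableD _ i1 i2) => //; first exact/measurable_EFinP.
move=> t _; rewrite /= lee_fin [leRHS]ger0_norm; last first.
  by rewrite addr_ge0// sqr_ge0.
by rewrite ler_norml; apply/andP; split; nra.
Qed.

Variables (u ut : R -> T -> R) (g : R -> R) (j j' : R -> R) (A B L k a b : R).
Hypothesis ab : a < b.
Hypothesis uL2 : forall t, a <= t -> inL2 nu (u t).
Hypothesis gi : leb.-integrable `[a, b] (EFin \o g).
Hypothesis u_ac : forall s t, a <= s -> s <= t -> t <= b ->
  Num.sqrt (\int[nu]_x ((u t x - u s x) ^+ 2)) <= \int[leb]_(r in `[s, t]) g r.
Hypothesis mj : measurable_fun setT j.
Hypothesis mj' : measurable_fun setT j'.
Hypothesis L0 : 0 <= L.
Hypothesis j_taylor : forall x y, j y <= j x + j' x * (y - x) + L * (y - x) ^+ 2.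
Hypothesis B0 : 0 <= B.
Hypothesis j_le : forall x, `|j x| <= A + B * x ^+ 2.
Hypothesis j'_le : forall x, j' x ^+ 2 <= A + B * x ^+ 2.

Lemma inL2_comp_deriv v : inL2 nu v -> inL2 nu (fun x => j' (v x)).
Proof.
move=> vL; apply: (inL2_le vL _ (integrable_cst_fun nu_fin A) _) => //.
by apply: measurableT_comp => //; exact: inL2_meas vL.
Qed.

Lemma integrable_comp_inL2 v : inL2 nu v ->
  nu.-integrable setT (fun x => (j (v x))%:E).
Proof.
move=> vL.
apply: (le_integrable_fun _ (integrableD_fun (integrable_cst_fun nu_fin A)
  (integrableZ_fun B (inL2_sqr vL)))) => //.
by apply: measurableT_comp => //; exact: inL2_meas vL.
Qed.

Lemma Rintegral_taylor v w : inL2 nu v -> inL2 nu w ->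
  \int[nu]_x j (w x) - \int[nu]_x j (v x) <=
  \int[nu]_x (j' (v x) * (w x - v x)) + L * \int[nu]_x ((w x - v x) ^+ 2).
Proof.
move=> vL wL; have iv := integrable_comp_inL2 vL.
have iw := integrable_comp_inL2 wL.
have wvL := inL2B wL vL.
have i1 := inL2M (inL2_comp_deriv vL) wvL; have i2 := inL2_sqr wvL.
rewrite -RintegralB// -RintegralZl// -RintegralD//; last exact: integrableZ_fun.
apply: le_Rintegral => //; first exact: integrableB_fun.
  by apply: integrableD_fun => //; exact: integrableZ_fun.
by move=> x _; have := j_taylor (v x) (w x); lra.
Qed.

Hypothesis u_deriv : {ae leb, forall t, a <= t -> t < b -> [/\ inL2 nu (ut t),
  (fun h => L2sq nu (fun x => (u (t + h) x - u t x) / h) (ut t)) @ 0^' --> 0%E &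
  \int[nu]_x (j' (u t x) * ut t x) <= - k]}.

Let giA (s t : R) : a <= s -> t <= b -> leb.-integrable `[s, t] (EFin \o g).
Proof.
move=> as_ tb; apply: integrableS gi => //.
by apply: subset_itvScc; rewrite bnd_simp.
Qed.

Let g1 := \int[leb]_(r in `[a, b]) `|g r|.
Let N f := Num.sqrt (\int[nu]_x (f x ^+ 2)).

(** [g] may change sign; with [|g|] the integral over a subinterval is at most the one over
    [[a, b]]. *)
Let u_ac1 s t : a <= s -> s <= t -> t <= b ->
  N (fun x => u t x - u s x) <= \int[leb]_(r in `[s, t]) `|g r|.
Proof.
move=> as_ st tb; apply: le_trans (u_ac as_ st tb) _.
apply: le_trans (ler_norm _) _.
by apply: le_normr_Rintegral => //; exact: giA.
Qed.

Let u_ac2 s t : a <= s -> s <= t -> t <= b ->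
  \int[leb]_(r in `[s, t]) `|g r| <= g1.
Proof.
move=> as_ st tb; rewrite /g1 /Rintegral fine_le//.
- by apply: integrable_fin_num => //; apply: integrable_norm; exact: giA.
- by apply: integrable_fin_num => //; exact: integrable_norm.
apply: ge0_subset_integral => //=.
- by have /integrable_norm/measurable_int := gi.
- by apply: subset_itvScc; rewrite bnd_simp.
Qed.

Let g10 : 0 <= g1. Proof. by apply: Rintegral_ge0. Qed.

(** A bound for [\int j'(u s)^2] uniform in [s] on [[a, b]]: insert [u s = u a + (u s - u a)], whose
    second term has norm at most [g1], in the growth bound on [j']. *)
Let Q := A * fine (nu setT) + B * (2 * \int[nu]_x (u a x ^+ 2) + 2 * g1 ^+ 2).

Let deriv_norm_le s : a <= s -> s <= b -> N (fun x => j' (u s x)) <= Num.sqrt Q.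
Proof.
move=> as_ sb; rewrite ler_wsqrtr//.
have us := uL2 as_; have ua := uL2 (lexx a).
have h1 : \int[nu]_x (j' (u s x) ^+ 2) <= \int[nu]_x (A + B * u s x ^+ 2).
  apply: le_Rintegral => //; first exact/inL2_sqr/inL2_comp_deriv.
  apply: integrableD_fun; first exact: integrable_cst_fun.
  by apply: integrableZ_fun; exact: inL2_sqr.
apply: le_trans h1 _.
rewrite RintegralD//; [|exact: integrable_cst_fun|]; last first.
  by apply: integrableZ_fun; exact: inL2_sqr.
rewrite RintegralZl//; last exact: inL2_sqr.
rewrite Rintegral_cst// lerD2l ler_wpM2l//.
have := Rintegral_sqrD_le ua (inL2B us ua).
under eq_Rintegral do rewrite addrC subrK.
move=> /le_trans; apply; rewrite lerD2l ler_pM2l//.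
have := le_trans (u_ac1 (lexx a) as_ sb) (u_ac2 (lexx a) as_ sb).
rewrite /N => h; rewrite -ler_sqrt ?sqr_ge0//.
by rewrite sqrtr_sqr ger0_norm.
Qed.

(** The Taylor bound is used twice: crudely, with Cauchy-Schwarz, for a majorant of all increments,
    and sharply at almost every [t], where the difference quotient of [u] is close to [ut t] in
    L2. *)
Lemma Rintegral_comp_decrease :
  \int[nu]_x j (u b x) + k * (b - a) <= \int[nu]_x j (u a x).
Proof.
(* With [D] the integral of [|g|] over [[s, t]], the linear Taylor term is at most [sqrt Q * D] and
   the quadratic one at most [L * D^2 <= L * g1 * D]. *)
pose C := Num.sqrt Q + L * g1.
have C0 : 0 <= C by rewrite addr_ge0// mulr_ge0.
pose f t := \int[nu]_x j (u t x) + k * t.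
suff : f b <= f a by rewrite /f; lra.
pose G0 r := C * `|g r| + `|k|.
have ik (D : set R) : measurable D -> (leb D < +oo)%E ->
    leb.-integrable D (EFin \o cst `|k|).
  by move=> mD D1; apply: measurable_bounded_integrable => //; exact: bounded_cst.
have itvfin (s t : R) : (leb `[s, t] < +oo)%E.
  by rewrite /= lebesgue_measure_itv/=; case: ifP => _; exact: ltry.
have iG1 (s t : R) : a <= s -> t <= b ->
    leb.-integrable `[s, t] (EFin \o (fun r => C * `|g r|)).
  move=> as_ tb.
  by have := integrableZl _ C (integrable_norm (giA as_ tb)); exact.
have iG0 : leb.-integrable `[a, b] (EFin \o G0).
  have ikab : leb.-integrable `[a, b] (EFin \o cst `|k|) by apply: ik => //; exact: itvfin.
  by have := integrableD _ (iG1 a b (lexx _) (lexx _)) ikab; exact.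
have G00 r : 0 <= G0 r by rewrite addr_ge0// mulr_ge0.
apply: (@ae_upper_derivative_le0 _ f (G0 \_ `[a, b])) => //.
- by rewrite -restrict_EFin; apply/(integrable_mkcond _ _).1.
- by move=> r; rewrite patchE; case: ifP.
- move=> s t as_ st tb.
  have -> : \int[leb]_(r in `[s, t]) (G0 \_ `[a, b]) r =
            C * \int[leb]_(r in `[s, t]) `|g r| + `|k| * (t - s).
    transitivity (\int[leb]_(r in `[s, t]) (C * `|g r| + `|k|)).
      apply: eq_Rintegral => r; rewrite inE/= in_itv/= => /andP[sr rt].
      by rewrite patchE ifT// inE/= in_itv/=; lra.
    rewrite RintegralD//; [|exact: iG1|exact: ik].
    rewrite RintegralZl//; last exact/integrable_norm/giA.
    rewrite Rintegral_cst//; congr (_ + _ * _).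
    rewrite /= lebesgue_measure_itv/= lte_fin; case: ifPn => //= sht.
    by rewrite -leNgt in sht; lra.
  have us := uL2 as_; have ut' := uL2 (le_trans as_ st).
  set D := \int[leb]_(r in `[s, t]) `|g r|.
  have ND := u_ac1 as_ st tb.
  have Dg := u_ac2 as_ st tb.
  have N0 : 0 <= N (fun x => u t x - u s x) by exact: sqrtr_ge0.
  have sb : s <= b by lra.
  have h1 := Rintegral_taylor us ut'.
  have h2 := Cauchy_Schwarz_inL2 (inL2_comp_deriv us) (inL2B ut' us).
  have h3 := deriv_norm_le as_ sb.
  have h4 : k * (t - s) <= `|k| * (t - s).
    by rewrite ler_wpM2r ?subr_ge0 ?ler_norm.
  have h5 : N (fun x => j' (u s x)) * N (fun x => u t x - u s x) <= Num.sqrt Q * D.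
    by apply: ler_pM => //; exact: sqrtr_ge0.
  have h6 : \int[nu]_x ((u t x - u s x) ^+ 2) <= g1 * D.
    rewrite -[leLHS]sqr_sqrtr; last by apply: Rintegral_ge0 => x _; exact: sqr_ge0.
    rewrite expr2; apply: ler_pM => //; exact: le_trans ND Dg.
  have h7 : L * \int[nu]_x ((u t x - u s x) ^+ 2) <= L * (g1 * D) by rewrite ler_wpM2l.
  have h8 := ler_norm (\int[nu]_x (j' (u s x) * (u t x - u s x))).
  rewrite /f /C mulrDl -[L * g1 * D]mulrA; rewrite /N in h5; lra.
have [E [mE E0 subE]] := u_deriv; exists E; split => // t /= nP.
apply: subE => ht; apply: nP => at_ tb e eta e0 eta0.
have [utL cvg_ut jut] := ht at_ tb.
have us := uL2 at_.
pose P := N (fun x => j' (u t x)).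
pose Y := \int[nu]_x (ut t x ^+ 2).
have P0 : 0 <= P by exact: sqrtr_ge0.
have Y0 : 0 <= Y by apply: Rintegral_ge0 => x _; exact: sqr_ge0.
(* [rho] is the L2 distance allowed between the difference quotient and [ut t]: it makes the linear
   error [P * rho] at most [e / 2], and [rho <= 1] keeps the squared norm of the quotient below
   [2 + 2 * Y]. *)
pose rho := Num.min 1 (e / 2 / (P + 1)).
have rho0 : 0 < rho by rewrite lt_min ltr01/= !divr_gt0// ltr_wpDl.
have rho1 : rho <= 1 by rewrite ge_min lexx.
have rhoP : P * rho <= e / 2.
  have : rho <= e / 2 / (P + 1) by rewrite ge_min lexx orbT.
  rewrite ler_pdivlMr ?ltr_wpDl//; nra.
have : \forall h \near (0 : R)^',
    (L2sq nu (fun x => (u (t + h) x - u t x) / h)%R (ut t)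
     < (rho ^+ 2)%:E)%E.
  have r20 : (0 < (rho ^+ 2)%:E)%E by rewrite lte_fin exprn_gt0.
  have /= := cvg_ut [set z | (z < (rho ^+ 2)%:E)%E].
  by apply; exact: open_ereal_lt'.
move=> [r /= r0 Hr].
(* For [h <= q] the quadratic term [L * h^2 * (2 + 2 * Y)] is at most [h * (e / 2)]. *)
pose q := e / 2 / (L * (2 + 2 * Y) + 1).
have LY : 0 <= L * (2 + 2 * Y) by rewrite mulr_ge0// addr_ge0// mulr_ge0.
have q0 : 0 < q by rewrite !divr_gt0// ltr_wpDl.
have qLY : L * (2 + 2 * Y) * q <= e / 2.
  have : q * (L * (2 + 2 * Y) + 1) = e / 2 by rewrite divfK// gt_eqF// ltr_wpDl.
  by nra.
pose h := Num.min (Num.min (eta / 2) (r / 2)) q.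
have h0 : 0 < h by rewrite !lt_min q0 !divr_gt0.
have hq : h <= q by rewrite ge_min lexx orbT.
have heta : h < eta.
  have eta2 : eta / 2 < eta by lra.
  by rewrite /h !gt_min eta2.
have hr : h < r.
  have r2 : r / 2 < r by have : 0 < r := r0; lra.
  by rewrite /h !gt_min r2 orbT.
exists h; split => //.
have uth := uL2 (_ : a <= t + h).
have {}uth : inL2 nu (u (t + h)) by apply: uth; lra.
pose dl x := (u (t + h) x - u t x) / h.
have dlL : inL2 nu dl.
  by rewrite /dl; under eq_fun do rewrite mulrC; exact/inL2Z/inL2B.
have : (L2sq nu dl (ut t) < (rho ^+ 2)%:E)%E.
  by apply: Hr => /=; rewrite ?sub0r ?normrN ?gtr0_norm// gt_eqF.
rewrite L2sqE// lte_fin => dlrho.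
have hne : h != 0 by rewrite gt_eqF.
have uE x : u (t + h) x - u t x = h * dl x by rewrite /dl mulrC divfK.
have h1 := Rintegral_taylor us uth.
have jL := inL2_comp_deriv us.
have dL := inL2B dlL utL.
have E1 : \int[nu]_x (j' (u t x) * (u (t + h) x - u t x)) =
    h * (\int[nu]_x (j' (u t x) * ut t x) + \int[nu]_x (j' (u t x) * (dl x - ut t x))).
  have i1 := inL2M jL utL; have i2 := inL2M jL dL.
  rewrite -(RintegralD measurableT i1 i2).
  rewrite -(RintegralZl _ measurableT (integrableD_fun i1 i2)).
  by apply: eq_Rintegral => x _; rewrite uE; ring.
have E2 : \int[nu]_x ((u (t + h) x - u t x) ^+ 2) = h ^+ 2 * \int[nu]_x (dl x ^+ 2).
  rewrite -RintegralZl//; last exact: inL2_sqr.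
  by apply: eq_Rintegral => x _; rewrite uE exprMn.
have h2 : \int[nu]_x (j' (u t x) * (dl x - ut t x)) <= P * rho.
  apply: le_trans (ler_norm _) _; apply: le_trans (Cauchy_Schwarz_inL2 jL dL) _.
  rewrite ler_wpM2l//.
  by rewrite -[leRHS]ger0_norm ?(ltW rho0)// -sqrtr_sqr ler_wsqrtr// ltW.
have h3 : \int[nu]_x (dl x ^+ 2) <= 2 + 2 * Y.
  have := Rintegral_sqrD_le dL utL.
  under eq_Rintegral do rewrite subrK.
  move=> /le_trans; apply; rewrite lerD2r.
  have : rho ^+ 2 <= 1 by rewrite expr_le1// ltW.
  by lra.
have h4 : L * (h ^+ 2 * \int[nu]_x (dl x ^+ 2)) <= h * (e / 2).
  have : h * (L * (2 + 2 * Y)) <= e / 2.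
    by apply: le_trans qLY; rewrite [leRHS]mulrC ler_wpM2r.
  have : L * \int[nu]_x (dl x ^+ 2) <= L * (2 + 2 * Y) by rewrite ler_wpM2l.
  set Z := \int[nu]_x (dl x ^+ 2) => i1 i2.
  have -> : L * (h ^+ 2 * Z) = h * (h * (L * Z)) by ring.
  rewrite ler_pM2l//; apply: le_trans i2; by rewrite ler_pM2l.
rewrite E1 E2 in h1.
have h5 : h * (\int[nu]_x (j' (u t x) * ut t x) +
    \int[nu]_x (j' (u t x) * (dl x - ut t x))) <= h * (- k + e / 2).
  by rewrite ler_pM2l//; lra.
by rewrite /f; lra.
Qed.

End decrease.

(** * The p-Laplacian *)

Section trunc.
Context {R : realType}.
Implicit Types k s t : R.

Definition trunc k s := Num.max (- k) (Num.min k s).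

Lemma trunc_le k s t : s <= t -> trunc k s <= trunc k t.
Proof.
move=> st; rewrite /trunc ge_max !le_max lexx/=.
by rewrite le_min !ge_min lexx st !orbT.
Qed.

Lemma trunc_lip k s t : s <= t -> trunc k t - trunc k s <= t - s.
Proof.
rewrite /trunc => st.
case: (leP k s); case: (leP k t); case: (leP (- k) k); case: (leP (- k) s);
  case: (leP (- k) t); lra.
Qed.

Lemma norm_trunc_le k s : 0 <= k -> `|trunc k s| <= k.
Proof.
move=> k0; rewrite ler_norml /trunc le_max lexx/= ge_max ge_min lexx.
by rewrite andbT; lra.
Qed.

Lemma norm_trunc_le_id k s : 0 <= k -> `|trunc k s| <= `|s|.
Proof.
move=> k0; rewrite ler_norml /trunc; have [s0|s0] := leP 0 s.
  by rewrite ger0_norm//; case: (leP k s); case: (leP (- k) k); case: (leP (- k) s); lra.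
by rewrite ltr0_norm//; case: (leP k s); case: (leP (- k) k); case: (leP (- k) s); lra.
Qed.

Lemma trunc_id k s : `|s| <= k -> trunc k s = s.
Proof.
rewrite ler_norml => /andP[ks sk]; rewrite /trunc.
by have /min_idPr -> := sk; have /max_idPr -> := ks.
Qed.

Lemma measurable_trunc k : measurable_fun setT (trunc k).
Proof.
apply: measurable_maxr; first exact: measurable_cst.
by apply: measurable_minr; [exact: measurable_cst|exact: measurable_id].
Qed.

End trunc.

Section power_slope.
Context {R : realType}.
Variable p : R.
Hypothesis p1 : 1 < p.
Implicit Type s : R.

Definition power_slope s := `|s| `^ (p - 2) * s.

Lemma power_slopeN s : power_slope (- s) = - power_slope s.
Proof. by rewrite /power_slope normrN mulrN. Qed.

Lemma power_slope_le0 s : s <= 0 -> power_slope s <= 0.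
Proof. by move=> s0; rewrite mulr_ge0_le0// powR_ge0. Qed.

(** The left side is [|s|^(p - 1)] for nonzero [s], at most 1 when [|s| <= 1] and at most [|s|^p]
    beyond. On a finite measure this makes the flux integrable as soon as the p-energy is finite. *)
Lemma norm_power_slope_le s : `|power_slope s| <= 1 + `|s| `^ p.
Proof.
rewrite /power_slope normrM ger0_norm ?powR_ge0//.
have [->|s0] := eqVneq s 0; first by rewrite normr0 mulr0 addr_ge0// powR_ge0.
have s1 : 0 < `|s| by rewrite normr_gt0.
rewrite -{2}(powRr1 (ltW s1)) -powRD; last by apply/implyP => _; rewrite gt_eqF.
have -> : p - 2 + 1 = p - 1 by lra.
have [le1|gt1] := leP `|s| 1.
  rewrite ler_wpDr ?powR_ge0//.
  have p10 : 0 <= p - 1 by rewrite subr_ge0 ltW.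
  have := ge0_ler_powR p10 (_ : `|s| \in Num.nneg) (_ : 1 \in Num.nneg) le1.
  by rewrite powR1; apply; rewrite nnegrE.
by rewrite ler_wpDl// ler_powR//; lra.
Qed.

Lemma measurable_power_slope : measurable_fun setT power_slope.
Proof.
apply: measurable_funM => //.
apply: (@measurableT_comp _ _ _ _ _ _ (@powR R ^~ (p - 2))) => //.
Qed.

End power_slope.

Section Rintegral_ae_sub.
Context {d : measure_display} {T : measurableType d} {R : realType}.
Variable nu : {measure set T -> \bar R}.
Implicit Types a b : T -> \bar R.

Lemma integral_fineK a : nu.-integrable setT a ->
  (\int[nu]_x a x = (fine (\int[nu]_x a x))%:E)%E.
Proof. by move=> ia; rewrite fineK// integrable_fin_num. Qed.

(** [a] and [b] stand for inner kernel integrals, which are finite only almost everywhere; hence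
    their extended values. *)
Lemma Rintegral_ae_sub (f : T -> R) a b : measurable_fun setT f ->
  nu.-integrable setT a -> nu.-integrable setT b ->
  {ae nu, forall x, (f x)%:E = (a x - b x)%E} ->
  \int[nu]_x f x = fine (\int[nu]_x a x) - fine (\int[nu]_x b x).
Proof.
move=> mf ia ib fab; rewrite -fineB ?integrable_fin_num// -integralB//.
rewrite /Rintegral; congr fine; apply: ae_eq_integral => //.
- exact/measurable_EFinP.
- by apply: emeasurable_funB; [exact: measurable_int ia|exact: measurable_int ib].
- by apply: filterS fab => x + _.
Qed.

End Rintegral_ae_sub.

Section kernel_sections.
Context {d : measure_display} {T : measurableType d} {R : realType}.
Variable m : R.-pker T ~> T.

Lemma measurable_kernel_section (F : T * T -> R) (x : T) : measurable_fun setT F ->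
  measurable_fun setT (fun y => (F (x, y))%:E).
Proof.
by move=> mF; apply/measurable_EFinP/measurableT_comp => //; exact: measurable_fun_pair.
Qed.

Lemma measurable_kernel_Rsection (F : T * T -> R) : measurable_fun setT F -> (forall z, 0 <= F z) ->
  measurable_fun setT (fun x => \int[m x]_y (F (x, y))%:E)%E.
Proof.
move=> mF F0; apply: (@measurable_fun_kernel_integral _ _ _ m (fun z => (F z)%:E)).
by split; [exact/measurable_EFinP|move=> z; rewrite lee_fin].
Qed.

End kernel_sections.

(** * Divergence of an antisymmetric nonlocal flux *)

Section antisymmetric_flux.
Context {d : measure_display} {T : measurableType d} {R : realType}.
Variables (m : R.-pker T ~> T) (nu : {measure set T -> \bar R}).
Hypothesis rev_m : reversible m nu.
Hypothesis nu_fin : fin_num_fun nu.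
Variables (Kp dom : T * T -> R) (u w : T -> R).
Hypothesis mKp : measurable_fun setT Kp.
Hypothesis mdom : measurable_fun setT dom.
Hypothesis Kp0 : forall z, 0 <= Kp z.
Hypothesis dom0 : forall z, 0 <= dom z.
Hypothesis Kp_dom : forall z, Kp z <= dom z.
Hypothesis domC : forall x y, dom (y, x) = dom (x, y).
Hypothesis dom_fin : (\int[nu]_x \int[m x]_y (dom (x, y))%:E < +oo)%E.
Hypothesis KpN : forall x y, u y <= u x -> Kp (x, y) = 0.
Hypothesis wL : inL2 nu w.
Hypothesis wE : {ae nu, forall x, w x = \int[m x]_y (Kp (x, y) - Kp (y, x))}.

Let msec1 := @measurable_kernel_section _ T R.
Let mint := @measurable_kernel_Rsection _ T R m.

Let dom_int (F : T * T -> R) (C : R) : measurable_fun setT F ->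
  (forall z, 0 <= F z) -> 0 <= C -> (forall x y, F (x, y) <= C * dom (x, y)) ->
  nu.-integrable setT (fun x => \int[m x]_y (F (x, y))%:E)%E.
Proof.
move=> mF F0 C0 FC; apply/integrableP; split; first exact: mint.
have i0 x : (0 <= \int[m x]_y (F (x, y))%:E)%E.
  by apply: integral_ge0 => y _; rewrite lee_fin.
under eq_integral do rewrite gee0_abs//.
apply: (@le_lt_trans _ _ (C%:E * \int[nu]_x \int[m x]_y (dom (x, y))%:E)%E).
  rewrite -ge0_integralZl//; last 2 first.
  - exact: mint.
  - by move=> x _; apply: integral_ge0 => y _; rewrite lee_fin.
  apply: ge0_le_integral => //; first exact: mint.
    by apply: measurable_funeM; exact: mint.
  move=> x _; rewrite -ge0_integralZl//; last 2 first.
  - exact: msec1.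
  - by move=> y _; rewrite lee_fin.
  apply: ge0_le_integral => //.
  - by move=> y _; rewrite lee_fin.
  - exact: msec1.
  - by apply: measurable_funeM; exact: msec1.
  - by move=> y _; rewrite -EFinM lee_fin.
by rewrite lte_mul_pinfty.
Qed.

(** Integration by parts: [\int psi w] is the double integral of [(psi x - psi y) * Kp (x, y)].
    Writing the flux as [Kp (x, y) - Kp (y, x)] keeps both terms nonnegative, so reversibility can
    swap the variables in the second; [A] and [B] record that both are finite. *)
Lemma flux_weak (psi : T -> R) (C : R) : measurable_fun setT psi -> 0 <= C ->
  (forall x, 0 <= psi x) -> (forall x, psi x <= C) ->
  exists A B : R, [/\ (\int[nu]_x \int[m x]_y (psi x * Kp (x, y))%:E = A%:E)%E,
    (\int[nu]_x \int[m x]_y (psi y * Kp (x, y))%:E = B%:E)%E &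
    \int[nu]_x (psi x * w x) = A - B].
Proof.
move=> mpsi C0 psi0 psiC.
have mp1 : measurable_fun setT (fun z : T * T => psi z.1 * Kp z).
  by apply: measurable_funM => //; exact: measurableT_comp.
have mp2 : measurable_fun setT (fun z : T * T => psi z.2 * Kp z).
  by apply: measurable_funM => //; exact: measurableT_comp.
have mKs : measurable_fun setT (fun z : T * T => Kp (z.2, z.1)).
  by apply: measurableT_comp => //; exact: measurable_fun_swap_pair.
have mp3 : measurable_fun setT (fun z : T * T => psi z.1 * Kp (z.2, z.1)).
  by apply: measurable_funM => //; exact: measurableT_comp.
have psiK x a b : 0 <= a -> a <= b -> psi x * a <= C * b.
  by move=> a0 ab; apply: ler_pM.
pose a x := (\int[m x]_y (psi x * Kp (x, y))%:E)%E.
pose b x := (\int[m x]_y (psi x * Kp (y, x))%:E)%E.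
have ia : nu.-integrable setT a.
  by apply: (@dom_int _ C mp1) => // [z|x y]; [rewrite mulr_ge0|exact: psiK].
have ib : nu.-integrable setT b.
  apply: (@dom_int _ C mp3) => // [z|x y]; first by rewrite mulr_ge0.
  by apply: psiK => //; rewrite -domC.
have ic : nu.-integrable setT (fun x => \int[m x]_y (psi y * Kp (x, y))%:E)%E.
  by apply: (@dom_int _ C mp2) => // [z|x y]; [rewrite mulr_ge0|exact: psiK].
have bc : (\int[nu]_x b x = \int[nu]_x \int[m x]_y (psi y * Kp (x, y))%:E)%E.
  apply: (@ge0_reversible_integral _ _ _ _ _ rev_m
    (fun z => (psi z.1 * Kp (z.2, z.1))%:E)).
  by split => [|z]; [exact/measurable_EFinP|rewrite lee_fin mulr_ge0].
have fa : (\int[nu]_x a x = (fine (\int[nu]_x a x))%:E)%E.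
  exact: integral_fineK ia.
have fb : (\int[nu]_x b x = (fine (\int[nu]_x b x))%:E)%E.
  exact: integral_fineK ib.
exists (fine (\int[nu]_x a x)), (fine (\int[nu]_x b x)).
split; [exact: fa|by rewrite -bc; exact: fb|].
apply: (Rintegral_ae_sub _ ia ib).
  by apply: measurable_funM => //; exact: inL2_meas wL.
have idom : nu.-integrable setT (fun x => \int[m x]_y (dom (x, y))%:E)%E.
  by apply: (@dom_int _ 1) => // x y; rewrite mul1r.
have := integrable_ae measurableT idom.
move: wE; apply: filterS2 => x wxE /(_ I) fx.
have idx : (m x).-integrable setT (fun y => (dom (x, y))%:E).
  apply/integrableP; split; first exact: msec1.
  under eq_integral do rewrite gee0_abs ?lee_fin//.
  by rewrite -ge0_fin_numE// integral_ge0// => y _; rewrite lee_fin.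
have i1 : (m x).-integrable setT (fun y => (Kp (x, y))%:E).
  apply: (le_integrable_fun _ idx) => [|y]; last by rewrite ger0_norm.
  exact/measurable_EFinP/msec1.
have i2 : (m x).-integrable setT (fun y => (Kp (y, x))%:E).
  apply: (le_integrable_fun _ idx) => [|y]; last by rewrite ger0_norm// -domC.
  exact/measurable_EFinP/(msec1 _ mKs).
rewrite wxE RintegralB// mulrBr EFinB; congr (_ - _)%E.
  rewrite -RintegralZl// /Rintegral fineK//.
  by apply: integrable_fin_num => //; exact: integrableZ_fun.
rewrite -RintegralZl// /Rintegral fineK//.
by apply: integrable_fin_num => //; exact: integrableZ_fun.
Qed.

Let wi : nu.-integrable setT (fun x => (w x)%:E).
Proof. exact: inL2_integrable. Qed.

Lemma flux_integral0 : \int[nu]_x w x = 0.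
Proof.
have [||||A [B [EA EB]]] := @flux_weak (cst 1) 1 => //.
move: EB; rewrite EA => -[<-] /=; rewrite subrr.
by under eq_Rintegral do rewrite mul1r.
Qed.

(** [Kp (x, y)] vanishes unless [u x < u y], and there [psi x <= psi y]. The weak form wants a
    nonnegative test function, so [psi + C] is used; the shift is free since [w] has integral 0. *)
Lemma flux_monotone_le0 (psi : T -> R) (C : R) : measurable_fun setT psi ->
  (forall x, `|psi x| <= C) -> 0 <= C ->
  (forall x y, u x <= u y -> psi x <= psi y) ->
  \int[nu]_x (psi x * w x) <= 0.
Proof.
move=> mpsi psiC C0 mono.
have psiL : inL2 nu psi.
  apply: (@inL2_le _ _ _ _ (cst 0) psi (C ^+ 2) 0 (inL2_cst nu_fin 0) mpsi
    (integrable_cst_fun nu_fin (C ^+ 2))) => x.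
  by rewrite mul0r addr0 -[leLHS]real_normK ?num_real// lerXn2r ?nnegrE.
have ipw := inL2M psiL wL.
have mpsiC : measurable_fun setT (fun x => psi x + C).
  by apply: measurable_funD => //; exact: measurable_cst.
have psiC2 x : -C <= psi x <= C by rewrite -ler_norml.
have [|x|x|A [B [EA EB E]]] := @flux_weak _ (2 * C) mpsiC.
- by rewrite mulr_ge0.
- by have := psiC2 x; lra.
- by have := psiC2 x; lra.
have mq1 : measurable_fun setT (fun z : T * T => (psi z.1 + C) * Kp z).
  by apply: measurable_funM => //; apply: (measurableT_comp mpsiC).
have mq2 : measurable_fun setT (fun z : T * T => (psi z.2 + C) * Kp z).
  by apply: measurable_funM => //; apply: (measurableT_comp mpsiC).
have AB : A <= B.
  rewrite -lee_fin -EA -EB; apply: ge0_le_integral => //.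
  - move=> x _; apply: integral_ge0 => y _; rewrite lee_fin mulr_ge0//.
    by have := psiC2 x; lra.
  - apply: (mint mq1).
    by move=> z; rewrite mulr_ge0//; have := psiC2 z.1; lra.
  - apply: (mint mq2).
    by move=> z; rewrite mulr_ge0//; have := psiC2 z.2; lra.
  move=> x _; apply: ge0_le_integral => //.
  - by move=> y _; rewrite lee_fin mulr_ge0//; have := psiC2 x; lra.
  - exact: (msec1 x mq1).
  - exact: (msec1 x mq2).
  move=> y _; rewrite lee_fin; have [yx|xy] := leP (u y) (u x).
    by rewrite KpN// !mulr0.
  by rewrite ler_wpM2r// lerD2r mono// ltW.
move: E; under eq_Rintegral do rewrite mulrDl.
rewrite RintegralD//; last exact: integrableZ_fun.
by rewrite RintegralZl// flux_integral0; lra.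
Qed.

End antisymmetric_flux.

Section pLaplacian.
Context {d : measure_display} {T : measurableType d} {R : realType}.
Variables (m : R.-pker T ~> T) (nu : {measure set T -> \bar R}) (p : R).
Variables u w : T -> R.
Hypothesis rev_m : reversible m nu.
Hypothesis nu_fin : fin_num_fun nu.
Hypothesis p1 : 1 < p.
Hypothesis uw : Deltap m nu p u w.

Let mu : measurable_fun setT u. Proof. by have [/inL2_meas] := uw. Qed.
Let wL : inL2 nu w. Proof. by have [_ []] := uw. Qed.

Let grad (z : T * T) := u z.2 - u z.1.
Let K z := power_slope p (grad z).
Let Kp z := Num.max (K z) 0.
(** Symmetric in its two variables, so it dominates [Kp (y, x)] as well as [Kp (x, y)]. *)
Let dom z := 1 + `|grad z| `^ p.

Let mgrad : measurable_fun setT grad.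
Proof. by apply: measurable_funB; exact: measurableT_comp. Qed.

Let mK : measurable_fun setT K.
Proof. by apply: measurableT_comp => //; exact: measurable_power_slope. Qed.

Let mKp : measurable_fun setT Kp.
Proof. by apply: measurable_maxr => //; exact: measurable_cst. Qed.

Let mdomp : measurable_fun setT (fun z => `|grad z| `^ p).
Proof.
apply: (@measurableT_comp _ _ _ _ _ _ (@powR R ^~ p)) => //.
exact: measurableT_comp.
Qed.

Let mdom : measurable_fun setT dom.
Proof. by apply: measurable_funD => //; exact: measurable_cst. Qed.

Let Kp0 z : 0 <= Kp z. Proof. by rewrite le_max lexx orbT. Qed.

(** [K] is odd under the swap, so [Kp (y, x)] is the negative part of [K (x, y)]. *)
Let KE x y : K (x, y) = Kp (x, y) - Kp (y, x).
Proof.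
have E : K (y, x) = - K (x, y) by rewrite /K -power_slopeN /grad/= opprB.
by rewrite /Kp E; case: (leP (K (x, y)) 0); case: (leP (- K (x, y)) 0); lra.
Qed.

Let KpN x y : u y <= u x -> Kp (x, y) = 0.
Proof.
move=> yx; rewrite /Kp; apply/max_idPr; apply: power_slope_le0.
by rewrite /grad/=; lra.
Qed.

Let Kp_dom z : Kp z <= dom z.
Proof.
have := norm_power_slope_le p1 (grad z).
by rewrite /Kp ge_max ler_norml => /andP[_ ->]/=; rewrite addr_ge0// powR_ge0.
Qed.

Let dom0 z : 0 <= dom z. Proof. exact: le_trans (Kp0 _) (Kp_dom _). Qed.

Let msec1 := @measurable_kernel_section _ T R.
Let mint := @measurable_kernel_Rsection _ T R m.

Let dom_fin : (\int[nu]_x \int[m x]_y (dom (x, y))%:E < +oo)%E.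
Proof.
have [_ [_ [gp _]]] := uw.
have E x : (\int[m x]_y (dom (x, y))%:E =
    1 + \int[m x]_y ((`|u y - u x| `^ p)%:E))%E.
  under eq_integral do rewrite EFinD.
  rewrite ge0_integralD//.
  - by rewrite integral_cst// prob_kernel mule1.
  - exact: (@msec1 (fun z => `|grad z| `^ p)).
under eq_integral do rewrite E.
rewrite ge0_integralD//.
- by rewrite integral_cst// mul1e lte_add_pinfty// ltey_eq nu_fin.
- by move=> x _; apply: integral_ge0 => y _; rewrite lee_fin powR_ge0.
- by apply: (@mint (fun z => `|grad z| `^ p)) => // z; exact: powR_ge0.
Qed.

Let domC x y : dom (y, x) = dom (x, y).
Proof. by rewrite /dom /grad/= distrC. Qed.

Let wE : {ae nu, forall x, w x = \int[m x]_y (Kp (x, y) - Kp (y, x))}.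
Proof.
have [_ [_ [_]]] := uw; apply: filterS => x ->.
by apply: eq_Rintegral => y _; rewrite -KE.
Qed.

Lemma Deltap_integral0 : \int[nu]_x w x = 0.
Proof. exact: (flux_integral0 rev_m mKp mdom Kp0 dom0 Kp_dom domC dom_fin wL wE). Qed.

Lemma Deltap_monotone_le0 (psi : T -> R) (C : R) : measurable_fun setT psi ->
  (forall x, `|psi x| <= C) -> 0 <= C ->
  (forall x y, u x <= u y -> psi x <= psi y) ->
  \int[nu]_x (psi x * w x) <= 0.
Proof.
exact: (flux_monotone_le0 rev_m nu_fin mKp mdom Kp0 dom0 Kp_dom domC dom_fin KpN wL wE).
Qed.

(** [u] itself may be unbounded; its truncations at level [n] are admissible, and [|u w|] dominates
    the passage to the limit. *)
Lemma Deltap_id_le0 : \int[nu]_x (u x * w x) <= 0.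
Proof.
have uL : inL2 nu u by case: uw.
have iuw := inL2M uL wL.
have cv x : (trunc n%:R (u x) * w x)%:E @[n --> \oo] --> (u x * w x)%:E.
  apply: cvg_near_cst; near=> n; rewrite trunc_id//.
  by near: n; exact: nbhs_infty_ger.
have mt (n : nat) : measurable_fun setT (fun x => trunc n%:R (u x)).
  by apply: measurableT_comp => //; exact: measurable_trunc.
have mw := inL2_meas wL.
have mf (n : nat) : measurable_fun setT (fun x => (trunc n%:R (u x) * w x)%:E).
  exact/measurable_EFinP/measurable_funM.
have [||||_ _] := @dominated_convergence _ _ _ nu setT measurableT
  (fun (n : nat) x => (trunc n%:R (u x) * w x)%:E) (fun x => (u x * w x)%:E)
  (fun x => `|u x * w x|%:E) mf.
- exact: measurable_int iuw.
- by apply: aeW => x _.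
- exact: integrable_norm iuw.
- apply: aeW => x n _; rewrite /= lee_fin !normrM ler_wpM2r//.
  exact: norm_trunc_le_id.
move=> cvn; rewrite -lee_fin /Rintegral fineK ?integrable_fin_num//.
apply: (cvge_to_le cvn); apply: nearW => n /=.
have tL : inL2 nu (fun x => trunc n%:R (u x)).
  apply: (@inL2_le _ _ _ _ u _ 0 1 uL (mt n)); first exact: integrable0.
  move=> x; rewrite add0r mul1r -[leLHS]real_normK ?num_real//.
  by rewrite -[leRHS]real_normK ?num_real// lerXn2r ?nnegrE// norm_trunc_le_id.
rewrite (integral_fineK (inL2M tL wL)) lee_fin.
apply: (@Deltap_monotone_le0 _ n%:R (mt n)) => // [x|x y xy].
- exact: norm_trunc_le.
- exact: trunc_le.
Unshelve. all: by end_near. Qed.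

End pLaplacian.

(** * The 1-Laplacian *)

Lemma integral_RintegralE {d : measure_display} {T : measurableType d} {R : realType}
    (nu : {measure set T -> \bar R}) (f : T -> R) :
  nu.-integrable setT (fun x => (f x)%:E) ->
  (\int[nu]_x (f x)%:E = (\int[nu]_x f x)%:E)%E.
Proof. exact: integral_fineK. Qed.

Section oneLaplacian.
Context {d : measure_display} {T : measurableType d} {R : realType}.
Variables (m : R.-pker T ~> T) (nu : {measure set T -> \bar R}).

Lemma F1_ge0 f : (0 <= F1 m nu f)%E.
Proof.
rewrite mule_ge0 ?lee_fin ?invr_ge0// integral_ge0// => x _.
by apply: integral_ge0 => y _; rewrite lee_fin.
Qed.

Lemma F1_le (f g : T -> R) : measurable_fun setT f -> measurable_fun setT g ->
  (forall x y, `|f y - f x| <= `|g y - g x|) -> (F1 m nu f <= F1 m nu g)%E.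
Proof.
move=> mf mg fg; rewrite lee_wpmul2l ?lee_fin ?invr_ge0//.
have md (h : T -> R) : measurable_fun setT h ->
    measurable_fun setT (fun z : T * T => `|h z.2 - h z.1|).
  move=> mh; apply: measurableT_comp => //.
  by apply: measurable_funB; exact: measurableT_comp.
apply: ge0_le_integral => //.
- by move=> x _; apply: integral_ge0 => y _; rewrite lee_fin.
- exact: (measurable_kernel_Rsection _ (md _ mf)).
- exact: (measurable_kernel_Rsection _ (md _ mg)).
move=> x _; apply: ge0_le_integral => //.
- exact: (measurable_kernel_section x (md _ mf)).
- exact: (measurable_kernel_section x (md _ mg)).
- by move=> y _; rewrite lee_fin.
Qed.

Variables u v : T -> R.
Hypothesis uv : subdiffF1 m nu u v.

Let uL : inL2 nu u. Proof. by case: uv. Qed.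
Let vL : inL2 nu v. Proof. by case: uv => _ []. Qed.

Lemma subdiffF1_id : (F1 m nu u <= (\int[nu]_x (u x * v x))%:E)%E.
Proof.
have zL : inL2 nu (fun=> 0 : R).
  by have := inL2Z 0 uL; under eq_fun do rewrite mul0r.
have [_ [_ /(_ _ zL)]] := uv.
have -> : F1 m nu (fun=> 0%R) = 0%E.
  rewrite /F1 integral0_eq ?mule0// => x _; apply: integral0_eq => y _.
  by rewrite subrr normr0.
have -> : (\int[nu]_x (v x * (0 - u x))%:E = (- \int[nu]_x (u x * v x))%:E)%E.
  have E x : (v x * (0 - u x))%:E = (-1 * (u x * v x))%:E :> \bar R.
    by congr EFin; ring.
  under eq_integral do rewrite E.
  rewrite (integral_RintegralE (integrableZ_fun (-1) (inL2M uL vL))).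
  by rewrite RintegralZl ?mulN1r//; exact: inL2M.
by rewrite EFinN sube_le0.
Qed.

(** Allows [F1 m nu u] to be cancelled from both sides of the subdifferential inequality. *)
Lemma subdiffF1_fin_num : F1 m nu u \is a fin_num.
Proof.
by rewrite ge0_fin_numE ?F1_ge0//; apply: le_lt_trans subdiffF1_id _; exact: ltry.
Qed.

Lemma subdiffF1_test psi : inL2 nu psi ->
  (F1 m nu (fun x => u x - psi x)%R <= F1 m nu u)%E ->
  0 <= \int[nu]_x (psi x * v x).
Proof.
move=> psiL le_u; have [_ [_ /(_ _ (inL2B uL psiL))]] := uv.
move=> /le_trans/(_ le_u).
have -> : (\int[nu]_x (v x * (u x - psi x - u x))%:E =
    (- \int[nu]_x (psi x * v x))%:E)%E.
  have E x : (v x * (u x - psi x - u x))%:E = (-1 * (psi x * v x))%:E :> \bar R.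
    by congr EFin; ring.
  under eq_integral do rewrite E.
  rewrite (integral_RintegralE (integrableZ_fun (-1) (inL2M psiL vL))).
  by rewrite RintegralZl ?mulN1r//; exact: inL2M.
rewrite -(fineK subdiffF1_fin_num) -EFinD lee_fin; lra.
Qed.

(** With Lipschitz constant 1 the choice [e = 1] is allowed: increments of [id - phi] lie between 0
    and those of [id], so [u - phi(u)] has smaller differences than [u]. *)
Lemma subdiffF1_contraction (phi : R -> R) : measurable_fun setT phi ->
  inL2 nu (fun x => phi (u x)) ->
  (forall s t, s <= t -> phi s <= phi t) ->
  (forall s t, s <= t -> phi t - phi s <= t - s) ->
  0 <= \int[nu]_x (phi (u x) * v x).
Proof.
move=> mphi phiL mono lip; apply: subdiffF1_test => //.
have mu := inL2_meas uL.
apply: F1_le => //; first exact: inL2_meas (inL2B uL phiL).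
move=> x y; have [xy|/ltW yx] := leP (u x) (u y).
  have := mono _ _ xy; have := lip _ _ xy => ? ?.
  by rewrite !ger0_norm; lra.
have := mono _ _ yx; have := lip _ _ yx => ? ?.
by rewrite !ler0_norm; lra.
Qed.

Hypothesis nu_fin : fin_num_fun nu.

(** [F1] is invariant under adding constants, and constants of both signs are tested. *)
Lemma subdiffF1_integral0 : \int[nu]_x v x = 0.
Proof.
have vi := inL2_integrable nu_fin vL.
have test k : 0 <= k * \int[nu]_x v x.
  rewrite -RintegralZl//; apply: subdiffF1_test; first exact: inL2_cst.
  apply: F1_le => [||x y]; first exact: inL2_meas (inL2B uL (inL2_cst nu_fin k)).
    exact: inL2_meas uL.
  by rewrite [X in `|X|](_ : _ = u y - u x)//; ring.
by have := test 1; have := test (-1); lra.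
Qed.

End oneLaplacian.

(** * Testing the evolution equation *)

Section operator_testing.
Context {d : measure_display} {T : measurableType d} {R : realType}.
Variables (m1 m2 : R.-pker T ~> T) (nu1 nu2 : {measure set T -> \bar R}).
Variables (mu : T -> R) (p : R) (u f : T -> R).
Hypothesis mmu : measurable_fun setT mu.
Hypothesis mu0 : forall x, 0 <= mu x.
Hypothesis nu2E : forall A, measurable A -> nu2 A = (\int[nu1]_(x in A) (mu x)%:E)%E.

Lemma opA_test : inL2 nu1 f -> opA m1 m2 nu1 nu2 mu p u (fun x => - f x) ->
  exists v w : T -> R, [/\ subdiffF1 m1 nu1 u v, Deltap m2 nu2 p u w &
    forall psi, inL2 nu1 psi ->
      \int[nu1]_x (psi x * f x) = \int[nu2]_x (psi x * w x) - \int[nu1]_x (psi x * v x)].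
Proof.
move=> fL [_ [_ [v [w [uv [uw fE]]]]]]; exists v, w.
have {}uv : subdiffF1 m1 nu1 u v.
  by move: uv; rewrite /Delta1; under eq_fun do rewrite opprK.
split => // psi psiL.
have [_ [vL _]] := uv; have [_ [[mw _] _]] := uw.
have mpsi := inL2_meas psiL; have mv := inL2_meas vL; have mf := inL2_meas fL.
(* [v + f = mu w] almost everywhere. Keeping [v + f] together means that only the products [psi v]
   and [psi f], both integrable for [nu1], have to be separated. *)
suff : \int[nu1]_x (psi x * (v x + f x)) = \int[nu2]_x (psi x * w x).
  under eq_Rintegral do rewrite mulrDr.
  by rewrite RintegralD//; [lra|exact: inL2M|exact: inL2M].
rewrite /Rintegral; congr fine.
rewrite (integral_density mmu mu0 nu2E); last exact/measurable_EFinP/measurable_funM.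
apply: ae_eq_integral => //.
- by apply/measurable_EFinP/measurable_funM => //; exact: measurable_funD.
- apply/measurable_EFinP; do 2 apply: measurable_funM => //.
apply: filterS fE => x fx _; rewrite -EFinM; congr EFin.
have -> : f x = mu x * w x - v x by lra.
by ring.
Qed.

End operator_testing.

(** * Huber regularisation of the absolute value *)

Section huber.
Context {R : realType}.
Implicit Types k s t : R.

(* The primitive of [trunc k]: [s^2 / 2] for [|s| <= k] and [k |s| - k^2 / 2] beyond. *)
Definition huber k s := trunc k s * s - trunc k s ^+ 2 / 2.

Lemma truncP k s : 0 <= k -> [\/ s <= - k /\ trunc k s = - k,
  (- k <= s /\ s <= k) /\ trunc k s = s | k <= s /\ trunc k s = k].
Proof.
move=> k0; have [sk|ks] := leP s (- k).
  constructor 1; split => //; rewrite /trunc.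
  by apply/max_idPl; rewrite ge_min sk orbT.
have [sk|/ltW {}sk] := leP s k.
  by constructor 2; split; [lra|apply: trunc_id; rewrite ler_norml; lra].
constructor 3; split => //; rewrite /trunc (min_idPl sk).
by apply/max_idPr; lra.
Qed.

(* With [D = trunc k t - trunc k s] and [E] the increment of [id - trunc k], both of
   the sign of [t - s = D + E], the claim reduces to [D E + D^2 / 2 <= (D + E)^2]. *)
Lemma huber_taylor k s t : 0 <= k ->
  huber k t <= huber k s + trunc k s * (t - s) + 1 * (t - s) ^+ 2.
Proof.
move=> k0; rewrite /huber.
have := norm_trunc_le t k0; rewrite ler_norml => /andP[Tk kT].
have DE : 0 <= (trunc k t - trunc k s) * ((t - trunc k t) - (s - trunc k s)).
  have [st|/ltW ts] := leP s t.
    by rewrite mulr_ge0//; [have := trunc_le k st|have := trunc_lip k st]; lra.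
  by rewrite mulr_le0//; [have := trunc_le k ts|have := trunc_lip k ts]; lra.
have Ds : (trunc k t - trunc k s) * (s - trunc k s) <= 0.
  case: (truncP s k0) => -[h ->].
  - by rewrite mulr_ge0_le0//; lra.
  - by rewrite subrr mulr0.
  - by rewrite mulr_le0_ge0//; lra.
have := sqr_ge0 (t - trunc k t - (s - trunc k s)).
have := sqr_ge0 (trunc k t - trunc k s).
by move: DE Ds; set Tt := trunc k t; set Ts := trunc k s; nra.
Qed.

(** On the middle range this is [(k - |s|)^2 >= 0]; outside it is an equality. *)
Lemma huber_ge k s : 0 <= k -> k * `|s| - k ^+ 2 / 2 <= huber k s.
Proof.
move=> k0; rewrite /huber; case: (truncP s k0) => -[h ->].
- by rewrite ler0_norm; lra.
- have : s ^+ 2 = `|s| ^+ 2 by rewrite real_normK ?num_real.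
  by have := sqr_ge0 (k - `|s|); nra.
- by rewrite ger0_norm; lra.
Qed.

Lemma huber_le k s : 0 <= k -> huber k s <= k * `|s|.
Proof.
move=> k0; rewrite /huber.
have : trunc k s * s <= k * `|s|.
  apply: le_trans (ler_norm _) _; rewrite normrM ler_wpM2r//.
  exact: norm_trunc_le.
by have := sqr_ge0 (trunc k s); lra.
Qed.

Lemma huber_ge0 k s : 0 <= k -> 0 <= huber k s.
Proof.
move=> k0; rewrite /huber; case: (truncP s k0) => -[h ->].
- have : 0 <= k * (- s - k) by rewrite mulr_ge0//; lra.
  by have := sqr_ge0 k; nra.
- by have := sqr_ge0 s; nra.
- have : 0 <= k * (s - k) by rewrite mulr_ge0//; lra.
  by have := sqr_ge0 k; nra.
Qed.

Lemma norm_huber_le k s : 0 <= k -> `|huber k s| <= s ^+ 2.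
Proof.
move=> k0; rewrite ger0_norm ?huber_ge0// /huber.
by have := sqr_ge0 (s - trunc k s); have := sqr_ge0 s; nra.
Qed.

Lemma measurable_huber k : measurable_fun setT (huber k).
Proof.
have mt := measurable_trunc k.
apply: measurable_funB; apply: measurable_funM => //.
exact: measurable_funX.
Qed.

End huber.

(** * Strong solutions *)

Section strong_solution.
Context {d : measure_display} {T : measurableType d} {R : realType}.
Notation leb := (@lebesgue_measure R).
Variables (p : R) (m1 m2 : R.-pker T ~> T) (nu1 nu2 : {measure set T -> \bar R}).
Variables (mu u0 : T -> R) (u : R -> T -> R) (lambda : R).
Hypothesis p1 : 1 < p.
Hypothesis rev2 : reversible m2 nu2.
Hypothesis mmu : measurable_fun setT mu.
Hypothesis mu0 : forall x, 0 <= mu x.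
Hypothesis nu2E : forall A, measurable A -> nu2 A = (\int[nu1]_(x in A) (mu x)%:E)%E.
Hypothesis nu1_fin : fin_num_fun nu1.
Hypothesis nu2_fin : fin_num_fun nu2.
Hypothesis lambda0 : 0 < lambda.
Hypothesis poincare : forall v : T -> R, inLr nu1 1 v ->
  ((lambda * fine (\int[nu1]_x (`|v x - mean nu1 v|)%:E))%:E <= F1 m1 nu1 v)%E.
Hypothesis u0L : inL2 nu1 u0.
Hypothesis sol : strong_solution m1 m2 nu1 nu2 mu p u0 u.

Let uL t : 0 <= t -> inL2 nu1 (u t). Proof. exact: (proj1 sol). Qed.

(** The last hypothesis ranges over all pairs [(v, w)] because the equation provides one only
    existentially, at almost every time. *)
Lemma solution_decrease (j j' : R -> R) (A B L k a b : R) : 0 < a -> a < b ->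
  measurable_fun setT j -> measurable_fun setT j' ->
  0 <= L -> (forall x y, j y <= j x + j' x * (y - x) + L * (y - x) ^+ 2) ->
  0 <= B ->
  (forall x, `|j x| <= A + B * x ^+ 2) ->
  (forall x, j' x ^+ 2 <= A + B * x ^+ 2) ->
  (forall t v w, a <= t -> t < b -> subdiffF1 m1 nu1 (u t) v ->
    Deltap m2 nu2 p (u t) w ->
    \int[nu2]_x (j' (u t x) * w x) - \int[nu1]_x (j' (u t x) * v x) <= - k) ->
  \int[nu1]_x j (u b x) + k * (b - a) <= \int[nu1]_x j (u a x).
Proof.
move=> a0 ab mj mj' L0 jT B0 jle j'le test.
have [_ [_ [_ [[g [gab gac]] [ut utP]]]]] := sol.
have gi : leb.-integrable `[a, b] (EFin \o g).
  by have [mg g2] := gab _ _ a0 ab; exact: (sqr_integrable_itv mg g2).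
apply: (@Rintegral_comp_decrease _ _ _ nu1 nu1_fin u ut g j j' A B L k a b
  ab _ gi _ mj mj' L0 jT B0 jle j'le).
- by move=> t at_; apply: uL; lra.
- move=> s t as_ st tb; have s0 : 0 < s by lra.
  have t0 : 0 <= t by lra.
  by have := gac _ _ s0 st; rewrite (L2sqE (uL t0) (uL (ltW s0))).
have [E [mE E0 subE]] := utP; exists E; split => // t /= nP.
apply: subE => /= ht; apply: nP => at_ tb.
have t0 : 0 < t by lra.
have [utL [cvut opAt]] := ht t0; split => //.
have [v [w [uv uw ->]]] := opA_test mmu mu0 nu2E utL opAt.
  exact: (test t v w).
by apply: (inL2_comp_deriv nu1_fin mj' j'le); apply: uL; lra.
Qed.

Let ui t : 0 <= t -> nu1.-integrable setT (fun x => (u t x)%:E).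
Proof. by move=> t0; exact: (inL2_integrable nu1_fin (uL t0)). Qed.

(** Applied with [sg = 1] and [sg = -1], it gives equality of the two masses. *)
Lemma solution_mass_le (sg a b : R) : 0 < a -> a < b ->
  sg * \int[nu1]_x u b x <= sg * \int[nu1]_x u a x.
Proof.
move=> a0 ab; have b0 : 0 < b by lra.
rewrite -!RintegralZl//; [|exact/ui/ltW|exact/ui/ltW].
have := @solution_decrease (fun s => sg * s) (cst sg) (sg ^+ 2) 1 0 0 a b a0 ab.
rewrite mul0r addr0; apply => //.
- by apply: measurable_funM.
- by move=> x y /=; lra.
- move=> x; rewrite mul1r ler_norml.
  have := sqr_ge0 (sg + x); have := sqr_ge0 (sg - x); have := sqr_ge0 x.
  by have := sqr_ge0 sg => *; apply/andP; split; nra.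
- by move=> x; rewrite /cst mul1r lerDl sqr_ge0.
move=> t v w at_ tb uv uw.
have [_ [vL _]] := uv; have [_ [wL _]] := uw.
rewrite !RintegralZl//; [|exact: inL2_integrable|exact: inL2_integrable].
rewrite (Deltap_integral0 rev2 nu2_fin p1 uw) (subdiffF1_integral0 uv nu1_fin).
by rewrite !mulr0 subrr oppr0.
Qed.

Let Rintegral_u0 (phi : R -> R) : measurable_fun setT phi ->
  \int[nu1]_x phi (u 0 x) = \int[nu1]_x phi (u0 x).
Proof.
move=> mphi; have [_ [u00 _]] := sol; rewrite /Rintegral; congr fine.
apply: ae_eq_integral => //.
- by apply/measurable_EFinP/measurableT_comp => //; exact: inL2_meas (uL (lexx 0)).
- by apply/measurable_EFinP/measurableT_comp => //; exact: inL2_meas u0L.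
- by apply: filterS u00 => x + _ => ->.
Qed.

Lemma solution_near0 (e : R) : 0 < e ->
  exists a, [/\ 0 < a, a < e & \int[nu1]_x ((u a x - u 0 x) ^+ 2) < e ^+ 2].
Proof.
move=> e0; have [_ [_ [cont _]]] := sol.
have := cont 0 (lexx 0).
move=> /(_ [set z | (z < (e ^+ 2)%:E)%E]) /=.
case; first by apply: open_ereal_lt'; rewrite lte_fin exprn_gt0.
move=> r /= r0 Hr.
have r00 : 0 < r := r0.
pose a := Num.min (r / 2) (e / 2).
have a0 : 0 < a by rewrite lt_min !divr_gt0.
have ar : a <= r / 2 by rewrite ge_min lexx.
have ae : a <= e / 2 by rewrite ge_min lexx orbT.
exists a; split => //; first by lra.
have : (L2sq nu1 (u a) (u 0) < (e ^+ 2)%:E)%E.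
  by apply: Hr; rewrite /= ?sub0r ?normrN ?gtr0_norm//; lra.
by rewrite (L2sqE (uL (ltW a0)) (uL (lexx 0))) lte_fin.
Qed.

Lemma solution_mass t : 0 < t -> \int[nu1]_x u t x = \int[nu1]_x u0 x.
Proof.
move=> t0.
have <- := Rintegral_u0 (@measurable_id _ R setT).
have V0 : 0 <= Num.sqrt (\int[nu1]_x ((1 : R) ^+ 2)) by exact: sqrtr_ge0.
set V := Num.sqrt _ in V0.
apply/eqP; rewrite -subr_eq0 -normr_le0; apply/ler_addgt0Pr => e e0.
pose dl := Num.min t (e / (V + 1)).
have V1 : 0 < V + 1 by lra.
have dl0 : 0 < dl by rewrite lt_min t0 divr_gt0.
have dlt : dl <= t by rewrite ge_min lexx.
have dle : dl * V <= e.
  have : dl <= e / (V + 1) by rewrite ge_min lexx orbT.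
  by rewrite ler_pdivlMr//; lra.
have [a [a0 ad an]] := solution_near0 dl0.
have at_ : a < t by lra.
have aL := uL (ltW a0); have oL := uL (lexx 0).
have := solution_mass_le 1 a0 at_; have := solution_mass_le (-1) a0 at_.
rewrite !mul1r !mulN1r lerN2 => le1 le2.
have -> : \int[nu1]_x u t x = \int[nu1]_x u a x by lra.
rewrite -RintegralB//; [|exact/ui/ltW|exact: ui].
have := Cauchy_Schwarz_inL2 (inL2B aL oL) (inL2_cst nu1_fin 1).
under eq_Rintegral do rewrite mulr1.
move=> /le_trans; apply; rewrite add0r; apply: le_trans dle.
rewrite ler_wpM2r// -[leRHS]ger0_norm ?(ltW dl0)// -sqrtr_sqr ler_wsqrtr//.
exact: ltW.
Qed.

Let c := mean nu1 u0.

Let meanE t : 0 < t -> mean nu1 (u t) = c.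
Proof. by move=> t0; have := solution_mass t0; rewrite /c /mean /Rintegral => ->. Qed.

Let dist t := \int[nu1]_x `|u t x - c|.

Let disti t : 0 <= t -> nu1.-integrable setT (fun x => `|u t x - c|%:E).
Proof.
move=> t0; apply: (@integrable_norm _ _ _ nu1 setT (fun x => u t x - c)).
exact: (inL2_integrable nu1_fin (inL2B (uL t0) (inL2_cst nu1_fin c))).
Qed.

Lemma solution_dist_nonincreasing a b : 0 < a -> a < b -> dist b <= dist a.
Proof.
move=> a0 ab; have b0 : 0 < b by lra.
have V0 : 0 <= fine (nu1 setT) by exact: fine_ge0.
set V := fine _ in V0.
apply/ler_addgt0Pr => e e0.
(* The Huber error integrates to at most [k^2 * V / 2], that is [k * V / 2 <= e] after division by
   [k]. *)
pose k := e / (V + 1).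
have V1 : 0 < V + 1 by lra.
have k0 : 0 < k by rewrite divr_gt0.
have k0' := ltW k0.
have kV : k * V <= e.
  have : k * (V + 1) = e by rewrite divfK// gt_eqF.
  by nra.
have mc : measurable_fun setT (fun s : R => s - c).
  by apply: measurable_funB => //; exact: measurable_cst.
have sqc s : (s - c) ^+ 2 <= 2 * c ^+ 2 + 2 * s ^+ 2.
  by have := sqr_ge0 (s + c); nra.
have mj : measurable_fun setT (fun s : R => huber k (s - c)).
  by apply: (measurableT_comp (measurable_huber k)).
have mj' : measurable_fun setT (fun s : R => trunc k (s - c)).
  by apply: (measurableT_comp (measurable_trunc k)).
have j'le s : trunc k (s - c) ^+ 2 <= 2 * c ^+ 2 + 2 * s ^+ 2.
  apply: le_trans (sqc s); rewrite -[leLHS]real_normK ?num_real//.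
  by rewrite -[leRHS]real_normK ?num_real// lerXn2r ?nnegrE// norm_trunc_le_id.
have jle s : `|huber k (s - c)| <= 2 * c ^+ 2 + 2 * s ^+ 2.
  exact: le_trans (norm_huber_le _ k0') (sqc s).
have := @solution_decrease (fun s => huber k (s - c)) (fun s => trunc k (s - c))
  (2 * c ^+ 2) 2 1 0 a b a0 ab mj mj' ler01 _ (ler0n _ _) jle j'le.
rewrite mul0r addr0 => dec.
have hub : \int[nu1]_x huber k (u b x - c) <= \int[nu1]_x huber k (u a x - c).
  apply: dec => [x y|t v w at_ tb uv uw].
    have := huber_taylor (x - c) (y - c) k0'.
    by have -> : y - c - (x - c) = y - x by ring.
  have t0 : 0 <= t by lra.
  have tL := inL2_comp_deriv nu1_fin mj' j'le (uL t0).
  have lev : 0 <= \int[nu1]_x (trunc k (u t x - c) * v x).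
    apply: (subdiffF1_contraction uv mj' tL) => s r sr.
      by apply: trunc_le; lra.
    by have := @trunc_lip _ k (s - c) (r - c); lra.
  have lew : \int[nu2]_x (trunc k (u t x - c) * w x) <= 0.
    apply: (Deltap_monotone_le0 rev2 nu2_fin p1 uw (C := k)) => //.
    - by apply: (measurableT_comp mj'); exact: inL2_meas (uL t0).
    - by move=> x; exact: norm_trunc_le.
    - by move=> x y xy; apply: trunc_le; lra.
  by rewrite oppr0; lra.
have ij t : 0 <= t -> nu1.-integrable setT (fun x => (huber k (u t x - c))%:E).
  by move=> t0; exact: (integrable_comp_inL2 nu1_fin mj jle (uL t0)).
have i1 := integrableZ_fun k (disti (ltW a0)).
have i2 := integrableZ_fun k (disti (ltW b0)).
have i3 := integrable_cst_fun nu1_fin (k ^+ 2 / 2).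
have h1 : k * dist b - k ^+ 2 / 2 * V <= \int[nu1]_x huber k (u b x - c).
  rewrite -RintegralZl//; last exact: disti (ltW b0).
  rewrite -Rintegral_cst// -RintegralB//.
  apply: le_Rintegral => //; [exact: integrableB_fun|exact: ij (ltW b0)|].
  by move=> x _; exact: huber_ge.
have h2 : \int[nu1]_x huber k (u a x - c) <= k * dist a.
  rewrite -RintegralZl//; last exact: disti (ltW a0).
  apply: le_Rintegral => //; first exact: ij (ltW a0).
  by move=> x _; exact: huber_le.
rewrite -(ler_pM2l k0).
have : k * (k * V) <= k * e by rewrite ler_pM2l.
have : 0 <= k * e by rewrite mulr_ge0// ltW.
by nra.
Qed.

Lemma solution_energy a b : 0 < a -> a < b ->
  lambda * dist b * (b - a) <= (\int[nu1]_x (u a x ^+ 2)) / 2.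
Proof.
move=> a0 ab; have b0 : 0 < b by lra.
have mj : measurable_fun setT (fun s : R => s ^+ 2 / 2).
  by apply: measurable_funM => //; exact: measurable_funX.
(* With [L = 1 / 2] the Taylor bound is an equality. The rate is frozen at [lambda * dist b], which
   is at most [lambda * dist t] for every [t < b]. *)
have := @solution_decrease (fun s => s ^+ 2 / 2) id 0 1 2^-1 (lambda * dist b) a b
  a0 ab mj.
have E t : 0 <= t ->
    \int[nu1]_x (u t x ^+ 2 / 2) = (\int[nu1]_x (u t x ^+ 2)) / 2.
  by move=> t0; rewrite RintegralZr//; exact/inL2_sqr/uL.
rewrite !E; [|exact: ltW|exact: ltW] => dec.
have pos : 0 <= \int[nu1]_x (u b x ^+ 2).
  by apply: Rintegral_ge0 => x _; exact: sqr_ge0.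
suff : \int[nu1]_x u b x ^+ 2 / 2 + lambda * dist b * (b - a) <=
  \int[nu1]_x u a x ^+ 2 / 2 by lra.
apply: dec => //.
- by move=> x y; have := sqr_ge0 (y - x); nra.
- by move=> x; have := sqr_ge0 x => h; rewrite ger0_norm; lra.
- by move=> x; rewrite add0r mul1r.
move=> t v w at_ tb uv uw; have t0 : 0 < t by lra.
have lew := Deltap_id_le0 rev2 nu2_fin p1 uw.
have lev := subdiffF1_id uv.
have uLr : inLr nu1 1 (u t).
  split; first exact: inL2_meas (uL (ltW t0)).
  under eq_integral do rewrite powRr1//.
  by apply: integrable_lty => //; exact: (integrable_norm (ui (ltW t0))).
have := le_trans (poincare uLr) lev.
rewrite meanE// lee_fin => lep.
have {}lep : lambda * dist t <= \int[nu1]_x (u t x * v x) by exact: lep.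
have : lambda * dist b <= lambda * dist t.
  by rewrite ler_pM2l//; exact: solution_dist_nonincreasing.
by move: lew lep; rewrite /=; lra.
Qed.

Lemma solution_L1_decay t : 0 < t ->
  lambda * dist t * t <= (\int[nu1]_x (u0 x ^+ 2)) / 2.
Proof.
move=> t0.
have <- := Rintegral_u0 (_ : measurable_fun setT (fun s : R => s ^+ 2)); last first.
  exact: measurable_funX.
have dist0 : 0 <= dist t by exact: Rintegral_ge0.
have oL := uL (lexx 0).
set X := \int[nu1]_x _.
pose S := Num.sqrt X.
have S0 : 0 <= S by exact: sqrtr_ge0.
(* [M] collects the costs, per unit of [dl], of passing from [a] to 0: replacing [t - a] by [t], the
   cross term of the expanded square, and half of [dl^2 <= dl]. *)
pose M := lambda * dist t + S + 1.
have ld0 : 0 <= lambda * dist t by rewrite mulr_ge0// ltW.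
have M0 : 0 < M by rewrite /M; lra.
apply/ler_addgt0Pr => e e0.
pose dl := Num.min (Num.min t 1) (e / M).
have dl0 : 0 < dl by rewrite !lt_min t0 divr_gt0//= ltr01.
have dlt : dl <= t by rewrite !ge_min lexx.
have dl1 : dl <= 1 by rewrite !ge_min lexx orbT.
have dle : dl * M <= e.
  have : dl <= e / M by rewrite ge_min lexx orbT.
  by rewrite ler_pdivlMr.
have [a [a0 ad an]] := solution_near0 dl0.
have at_ : a < t by lra.
have aL := uL (ltW a0).
have dL := inL2B aL oL.
have en := solution_energy a0 at_.
have nd : Num.sqrt (\int[nu1]_x ((u a x - u 0 x) ^+ 2)) <= dl.
  by rewrite -[leRHS]ger0_norm ?(ltW dl0)// -sqrtr_sqr ler_wsqrtr// ltW.
have cs : \int[nu1]_x (u 0 x * (u a x - u 0 x)) <= S * dl.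
  apply: le_trans (ler_norm _) _; apply: le_trans (Cauchy_Schwarz_inL2 oL dL) _.
  by rewrite ler_wpM2l.
have Ea : \int[nu1]_x (u a x ^+ 2) = X +
    (2 * \int[nu1]_x (u 0 x * (u a x - u 0 x)) + \int[nu1]_x ((u a x - u 0 x) ^+ 2)).
  have i1 := inL2M oL dL; have i2 := integrableZ_fun 2 i1; have i3 := inL2_sqr dL.
  rewrite -(RintegralZl 2 measurableT i1) -(RintegralD measurableT i2 i3).
  rewrite -(RintegralD measurableT (inL2_sqr oL) (integrableD_fun i2 i3)).
  by apply: eq_Rintegral => x _; ring.
have dl2 : dl ^+ 2 <= dl by rewrite expr2 ler_piMr// ltW.
have la : lambda * dist t * a <= lambda * dist t * dl by rewrite ler_wpM2l// ltW.
by move: dle en; rewrite Ea /M; lra.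
Qed.

End strong_solution.

Theorem theorem3p4 (d : measure_display) (T : measurableType d) (R : realType)
    (p : R) (m1 m2 : R.-pker T ~> T) (nu1 nu2 : {measure set T -> \bar R})
    (mu : T -> R) (c lambda : R) (u0 : T -> R) (u : R -> T -> R) :
  1 < p ->
  reversible_rws m1 nu1 -> reversible_rws m2 nu2 ->
  (nu2 `<< nu1) ->
  (* mu = d nu2 / d nu1 *)
  measurable_fun setT mu -> (forall x, 0 <= mu x) ->
  (forall A, measurable A -> nu2 A = (\int[nu1]_(x in A) (mu x)%:E)%E) ->
  (* mu in L^oo(X, nu1) *)
  (exists M : R, {ae nu1, forall x, `|mu x| <= M}) ->
  0 < c -> {ae nu1, forall x, c <= mu x} ->
  (nu1 setT < +oo)%E ->
  (* 1-Poincare inequality for F_{1,m1} with constant lambda *)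
  0 < lambda ->
  (forall v : T -> R, inLr nu1 1 v ->
     ((lambda * fine (\int[nu1]_x (`|v x - mean nu1 v|)%:E))%:E <= F1 m1 nu1 v)%E) ->
  inL2 nu1 u0 ->
  strong_solution m1 m2 nu1 nu2 mu p u0 u ->
  forall t, 0 < t ->
    (\int[nu1]_x (`|u t x - mean nu1 u0|)%:E <=
     ((2 * lambda)^-1 * fine (\int[nu1]_x ((u0 x ^+ 2)%:E)) / t)%:E)%E.
Proof.
move=> p1 _ [_ [_ rev2]] _ mmu mu0 nu2E [M muM] _ _ nu1_fin lambda0 poincare u0L sol.
move=> t t0.
have nu2_fin : (nu2 setT < +oo)%E.
  rewrite nu2E//.
  (* [|M|] because the almost everywhere bound leaves [M] free to be negative when [nu1] is the zero
     measure. *)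
  apply: (@le_lt_trans _ _ ((`|M|)%:E * nu1 setT)%E).
    have h := @integral_le_bound _ _ _ nu1 setT (EFin \o mu) `|M|%:E measurableT.
    under eq_integral do rewrite -[mu _]ger0_norm//.
    apply: h => //; first exact/measurable_EFinP.
    by apply: filterS muM => x muM _; rewrite /= lee_fin (le_trans muM)// ler_norm.
  by rewrite lte_mul_pinfty.
have {}nu1_fin : fin_num_fun nu1 by exact: lty_fin_num_fun.
have {}nu2_fin : fin_num_fun nu2 by exact: lty_fin_num_fun.
have := solution_L1_decay p1 rev2 mmu mu0 nu2E nu1_fin nu2_fin lambda0 poincare u0L sol t0.
have [uL _] := sol.
have iL : nu1.-integrable setT (fun x => `|u t x - mean nu1 u0|%:E).
  apply: (@integrable_norm _ _ _ nu1 setT (fun x => u t x - mean nu1 u0)).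
  exact: (inL2_integrable nu1_fin
    (inL2B (uL _ (ltW t0)) (inL2_cst nu1_fin (mean nu1 u0)))).
rewrite (integral_RintegralE iL) lee_fin -/(Rintegral nu1 setT (fun x => u0 x ^+ 2)).
set D := Rintegral _ _ _; set X := Rintegral _ _ _ => h.
rewrite ler_pdivlMr// [leRHS]mulrC ler_pdivlMr ?mulr_gt0//.
by lra.
Qed.
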